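(* Let $(X,T)$ be a t.d.s. and $f:X\to\mathbb{R}_{>0}$ a continuous function. If the suspension flow $(S_fX,\mathbb{R})$ has the small flow boundary property (SFBP), then $\mathrm{mdim}(S_fX,\mathbb{R})=0$.
   Context: A t.d.s. $(X,T)$ is a compact metrizable space with a homeomorphism $T$. A topological flow $(Z,\mathbb{R})$ is a compact metrizable space $Z$ with a continuous action $(t,z)\mapsto tz$ of $\mathbb{R}$; it is fixed-point free if no $z$ satisfies $tz=z$ for all $t$. The suspension space is $S_fX:=(X\times\mathbb{R})/\!\sim$, where $\sim$ is generated by $(x,s+f(x))\sim(Tx,s)$; it is compact metrizable, and the suspension flow is $t(x,s)=(x,s+t)$. SFBP (for a flow $(Z,\mathbb{R})$): for $A\subset Z$ write $[s,s']A=\{ta:t\in[s,s'],a\in A\}$. A cross-section with injectivity time $\eta>0$ is a set $S\subset Z$ such that $[-\eta,\eta]\times S\to Z$, $(t,z)\mapsto tz$, is injective. For a subset $U$ of a closed cross-section with injectivity time $\eta$, the flow interior is $\mathrm{Int}^{\mathbb{R}}U:=\mathrm{Int}([-\eta,\eta]U)\cap U$ (interior in $Z$) and the flow boundary is $\partial^{\mathbb{R}}U:=\overline U\setminus\mathrm{Int}^{\mathbb{R}}U$. A set is null if it has measure zero for every $\mathbb{R}$-invariant Borel probability measure on $Z$. A closed cross-section $S$ with injectivity time $\eta$ has a small flow boundary if $[-\eta,\eta](\partial^{\mathbb{R}}S)$ is null. The flow has SFBP if it is fixed-point free and for each $z\in Z$ and each closed cross-section $S'$ with $z\in\mathrm{Int}^{\mathbb{R}}(S')$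 there is a closed subset $S\subset S'$ such that $z\in\mathrm{Int}^{\mathbb{R}}(S)$ and $S$ has a small flow boundary. Mean dimension: for a compact metric space $(Z,d)$ and $\epsilon>0$, a continuous map $g:Z\to K$ is an $\epsilon$-embedding if $g(z_1)=g(z_2)$ implies $d(z_1,z_2)<\epsilon$; $\mathrm{Widim}_\epsilon(Z,d)$ is the minimum of the Lebesgue covering dimensions $\dim K$ over compact metrizable $K$ admitting an $\epsilon$-embedding $Z\to K$. For a flow with compatible metric $d$, put $d_N(x,y)=\max_{t\in[0,N]}d(tx,ty)$ and $\mathrm{mdim}(Z,\mathbb{R})=\lim_{\epsilon\to0}\lim_{N\to\infty}\frac{\mathrm{Widim}_\epsilon(Z,d_N)}{N}$ (independent of $d$). *)

(* Defs.v *)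
From HB Require Import structures.
From Stdlib Require Import Relation_Operators.
From mathcomp Require Import all_boot all_order all_algebra.
From mathcomp Require Import generic_quotient.
From mathcomp Require Import all_classical all_reals all_analysis.

Set Implicit Arguments.
Unset Strict Implicit.
Unset Printing Implicit Defensive.

Import Order.TTheory GRing.Theory Num.Theory.
Import numFieldNormedType.Exports.

Local Open Scope classical_set_scope.
Local Open Scope ring_scope.
Local Open Scope quotient_scope.

Section metrizable.
Context (R : realType) (Z : topologicalType).

Record compatible_metric (d : Z -> Z -> R) : Prop := CompatibleMetric {
  cmetricxx : forall x, d x x = 0 ;
  cmetric_positivity : forall x y, d x y = 0 -> x = y ;
  cmetric_sym : forall x y, d x y = d y x ;
  cmetric_triangle : forall y x z, d x z <= d x y + d y z ;
  cmetric_nbhs : forall x,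
    nbhs x = filter_from [set e : R | 0 < e] (fun e => [set y | d x y < e])
}.

Definition metrizable : Prop := exists d, compatible_metric d.

End metrizable.

Definition homeomorphism (X Y : topologicalType) (T : X -> Y) : Prop :=
  continuous T /\
  exists T' : Y -> X, [/\ continuous T', cancel T T' & cancel T' T].

Section covering_dimension.
Context (K : topologicalType).
Implicit Types (U V : set (set K)) (n : nat).

Definition open_cover U : Prop := U `<=` open /\ \bigcup_(A in U) A = setT.

Definition refines V U : Prop := forall B, V B -> exists2 A, U A & B `<=` A.

Definition multiplicity_le V n : Prop :=
  forall x, ([set B | V B /\ B x] #<= `I_n)%card.

(* The dimension is the least n - 1 such that every open cover has an open
   refinement of multiplicity at most n; it is -1 for the empty space and +oo
   when there is no such n. *)
Definition covering_dim (R : realType) : \bar R :=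
  ereal_inf [set ((n%:R : R) - 1)%:E | n in [set n : nat |
    forall U, open_cover U ->
      exists V, [/\ open_cover V, refines V U & multiplicity_le V n]]].

End covering_dimension.

Section flows.
Context (R : realType) (Z : topologicalType).
Implicit Types (phi : R -> Z -> Z) (d : Z -> Z -> R) (A S U : set Z).

Definition is_flow phi : Prop :=
  [/\ forall z, phi 0 z = z,
      forall s t z, phi (s + t) z = phi s (phi t z) &
      continuous (fun p : R * Z => phi p.1 p.2)].

Definition fixed_point_free phi : Prop :=
  ~ exists z, forall t, phi t z = z.

Definition sweep phi (a b : R) A : set Z :=
  [set phi t z | t in `[a, b] & z in A].

Definition cross_section phi (eta : R) S : Prop :=
  0 < eta /\ set_inj (`[- eta, eta] `*` S) (fun p => phi p.1 p.2).

Definition flow_interior phi (eta : R) U : set Z :=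
  (sweep phi (- eta) eta U)° `&` U.

Definition flow_boundary phi (eta : R) U : set Z :=
  closure U `\` flow_interior phi eta U.

End flows.

(* The library's measurable types are pointed. As Z may be empty, the Borel
   structure is put on a copy of Z pointed at a given z0; its sigma-algebra does
   not depend on z0. *)
Definition pointed_at (Z : topologicalType) (z0 : Z) : Type := Z.

HB.instance Definition _ (Z : topologicalType) (z0 : Z) :=
  Topological.on (pointed_at z0).
HB.instance Definition _ (Z : topologicalType) (z0 : Z) :=
  isPointed.Build (pointed_at z0) z0.

Definition borel (Z : topologicalType) (z0 : Z) :=
  g_sigma_algebraType (@open (pointed_at z0)).

Section sfbp.
Context (R : realType) (Z : topologicalType).
Implicit Types (phi : R -> Z -> Z) (A S : set Z).

Definition invariant_measure phi (z0 : Z)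
    (mu : probability (borel z0) R) : Prop :=
  forall (t : R) (A : set (borel z0)),
    measurable A -> mu (phi t @^-1` A) = mu A.

(* On Borel sets, mu.-negligible A means mu A = 0 (negligibleP). *)
Definition flow_null phi A : Prop :=
  forall (z0 : Z) (mu : probability (borel z0) R),
    invariant_measure phi mu -> mu.-negligible A.

Definition small_flow_boundary phi (eta : R) S : Prop :=
  flow_null phi (sweep phi (- eta) eta (flow_boundary phi eta S)).

(* A subset S of S' is a cross-section with the same injectivity time eta. *)
Definition SFBP phi : Prop :=
  fixed_point_free phi /\
  forall (z : Z) (eta : R) (S' : set Z),
    closed S' -> cross_section phi eta S' -> flow_interior phi eta S' z ->
    exists S : set Z, [/\ closed S, S `<=` S', flow_interior phi eta S z &
      small_flow_boundary phi eta S].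

End sfbp.

Section mean_dimension.
Context (R : realType) (Z : topologicalType).
Implicit Types (phi : R -> Z -> Z) (d : Z -> Z -> R).

Definition embedding_upto d (eps : R) (K : topologicalType) (g : Z -> K) :
    Prop :=
  continuous g /\ forall z1 z2, g z1 = g z2 -> d z1 z2 < eps.

Definition widim (eps : R) d : \bar R :=
  ereal_inf [set u | exists K : topologicalType,
    [/\ compact [set: K], metrizable R K,
        (exists g : Z -> K, embedding_upto d eps g) & u = covering_dim K R]].

Definition flow_metric phi d (N : R) (x y : Z) : R :=
  sup [set d (phi t x) (phi t y) | t in `[0, N]].

(* Both limits are asserted to exist, so that l is not the default value of the
   library's lim on a divergent filter. *)
Definition has_mdim phi d (l : \bar R) : Prop :=
  exists w : R -> \bar R,
    (forall eps : R, 0 < eps ->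
      (widim eps (flow_metric phi d N) * (N^-1)%:E)%E @[N --> +oo%R]
        --> w eps) /\
    w eps @[eps --> 0^'+] --> l.

End mean_dimension.

Section suspension.
Context (R : realType) (X : topologicalType) (T : X -> X) (f : X -> R).

Definition suspension_step (p q : X * R) : Prop :=
  exists x s, p = (x, s + f x) /\ q = (T x, s).

Definition suspension_eqv (p q : X * R) : bool :=
  `[< clos_refl_sym_trans _ suspension_step p q >].

Lemma suspension_eqv_refl : reflexive suspension_eqv.
Proof. by move=> p; apply/asboolP; exact: rst_refl. Qed.

Lemma suspension_eqv_sym : symmetric suspension_eqv.
Proof.
by move=> p q; apply/asboolP/asboolP; exact: rst_sym.
Qed.

Lemma suspension_eqv_trans : transitive suspension_eqv.
Proof.
by move=> q p r /asboolP pq /asboolP qr; apply/asboolP; exact: rst_trans pq qr.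
Qed.

Definition suspension_rel :=
  EquivRel _ suspension_eqv_refl suspension_eqv_sym suspension_eqv_trans.

Definition suspension := quotient_topology {eq_quot suspension_rel}.

HB.instance Definition _ := Topological.on suspension.
HB.instance Definition _ := Quotient.on suspension.

Definition suspension_flow (t : R) (z : suspension) : suspension :=
  \pi_suspension ((repr z).1, (repr z).2 + t).

Lemma suspension_piP p q :
  \pi_suspension p = \pi_suspension q <->
  clos_refl_sym_trans _ suspension_step p q.
Proof.
split; first by move=> /(@eqmodP _ suspension_rel _)/asboolP.
by move=> pq; apply/(@eqmodP _ suspension_rel _)/asboolP.
Qed.

Lemma suspension_flow_pi (t : R) (x : X) (s : R) :
  suspension_flow t (\pi_suspension (x, s)) = \pi_suspension (x, s + t).
Proof.
have shift p q : clos_refl_sym_trans _ suspension_step p q ->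
    clos_refl_sym_trans _ suspension_step (p.1, p.2 + t) (q.1, q.2 + t).
  elim=> [_ _ [y [r [-> ->]]]|p'|p' q' _|p' q' r' _ + _].
  - by apply: rst_step; exists y, (r + t) => /=; rewrite addrAC.
  - exact: rst_refl.
  - exact: rst_sym.
  - exact: rst_trans.
apply/suspension_piP/(shift (repr _) (x, s))/suspension_piP.
by rewrite reprK.
Qed.

Hypotheses (hT : homeomorphism T) (cf : continuous f).

Lemma suspension_pi_open (V : set (X * R)) (p : X * R) :
  nbhs p V -> nbhs (\pi_suspension p) (\pi_suspension @` V).
Proof.
have [cT [T' [cT' TK T'K]]] := hT.
pose G (q : X * R) := (T q.1, q.2 - f q.1).
pose G' (q : X * R) := (T' q.1, q.2 + f (T' q.1)).
have cfst (Y : topologicalType) (g : X -> Y) :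
    continuous g -> continuous (fun q : X * R => g q.1).
  move=> cg q; apply: (@continuous_comp _ _ _ fst g); first exact: cvg_fst.
  exact: cg.
have csnd : continuous (fun q : X * R => q.2) by move=> q; exact: cvg_snd.
have cG : continuous G.
  move=> q; exact: (cvg_pair (cfst _ _ cT q) (cvgB (csnd q) (cfst _ _ cf q))).
have cfT' : continuous (f \o T').
  by move=> x; apply: continuous_comp; [exact: cT'|exact: cf].
have cG' : continuous G'.
  move=> q.
  exact: (cvg_pair (cfst _ _ cT' q) (cvgD (csnd q) (cfst _ _ cfT' q))).
pose E := clos_refl_sym_trans _ suspension_step.
have EG q : E q (G q).
  apply: rst_step; exists q.1, (q.2 - f q.1).
  by rewrite subrK -surjective_pairing.
have EG' q : E (G' q) q.
  apply: rst_step; exists (T' q.1), q.2; split=> //.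
  by rewrite T'K -surjective_pairing.
have stepE q r : suspension_step q r -> r = G q /\ q = G' r.
  by move=> [x [s [-> ->]]]; rewrite /G /G' /= addrK TK.
pose sat (W : set (X * R)) := [set q | exists2 r, W r & E r q].
have satS W : W `<=` sat W by move=> q Wq; exists q => //; exact: rst_refl.
have satsat W : sat (sat W) `<=` sat W.
  by move=> q [r [r' Wr' r'r] rq]; exists r' => //; exact: rst_trans r'r rq.
have nsat q r : E q r -> forall W, (nbhs q W -> nbhs r (sat W)) /\
    (nbhs r W -> nbhs q (sat W)).
  elim=> {q r}.
  - move=> q r /stepE[rE qE] W; split=> [Wq|Wr].
      have : nbhs r (G' @^-1` W) by apply: cG'; rewrite -qE.
      by apply: filterS => z Wz; exists (G' z).
    have : nbhs q (G @^-1` W) by apply: cG; rewrite -rE.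
    by apply: filterS => z Wz; exists (G z) => //; exact: rst_sym (EG z).
  - by move=> q W; split; apply: filterS; exact: satS.
  - by move=> q r _ IH W; split=> h; [exact: ((IH W).2 h)|exact: ((IH W).1 h)].
  - move=> q r z _ IH1 _ IH2 W; split=> h.
      exact: (filterS (@satsat W) ((IH2 _).1 ((IH1 _).1 h))).
    exact: (filterS (@satsat W) ((IH1 _).2 ((IH2 _).2 h))).
move=> pV; pose O := (sat V)°.
have Op : O p by rewrite /O /interior; apply: filterS pV; exact: satS.
have OE : \pi_suspension @^-1` (\pi_suspension @` O) = O.
  rewrite eqEsubset; split=> q; last by move=> Oq; exists q.
  move=> [r Or] /suspension_piP rq; rewrite /O /interior.
  exact: (filterS (@satsat V) ((nsat _ _ rq _).1 Or)).
have oO : open (\pi_suspension @` O : set suspension).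
  suff : open (\pi_suspension @^-1` (\pi_suspension @` O)) by [].
  by rewrite OE; exact: open_interior.
have : nbhs (\pi_suspension p) (\pi_suspension @` O).
  by apply: open_nbhs_nbhs; split=> //; exists p.
apply: filterS => _ [q Oq <-].
by have [r Vr rq] := interior_subset Oq; exists r => //; apply/suspension_piP.
Qed.

Lemma suspension_flow_is_flow : is_flow (suspension_flow).
Proof.
split=> [z|s t z|].
- rewrite -(reprK z); case: (repr z) => x s.
  by rewrite suspension_flow_pi addr0.
- rewrite -(reprK z); case: (repr z) => x r.
  rewrite (suspension_flow_pi t x r) (suspension_flow_pi s x (r + t)).
  by rewrite (suspension_flow_pi (s + t) x r) (addrC s) addrA.
move=> [t z] W /=; rewrite -(reprK z); case: (repr z) => x s.
rewrite suspension_flow_pi => nW.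
pose h (q : R * (X * R)) : suspension := \pi_suspension (q.2.1, q.2.2 + q.1).
have ch : {for (t, (x, s)), continuous h}.
  apply: (@continuous_comp _ _ _ (fun q : R * (X * R) => (q.2.1, q.2.2 + q.1))
    (fun q => \pi_suspension q)); last exact: pi_continuous.
  have c1 : (fun q : R * (X * R) => q.1) @ (t, (x, s)) --> t by exact: cvg_fst.
  have c2 : {for (t, (x, s)), continuous (fun q : R * (X * R) => q.2)}.
    exact: cvg_snd.
  have c21 : (fun q : R * (X * R) => q.2.1) @ (t, (x, s)) --> x.
    by apply: (@continuous_comp _ _ _ _ fst _ c2); exact: cvg_fst.
  have c22 : (fun q : R * (X * R) => q.2.2) @ (t, (x, s)) --> s.
    by apply: (@continuous_comp _ _ _ _ snd _ c2); exact: cvg_snd.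
  exact: (cvg_pair c21 (cvgD c22 c1)).
have [[A B] /= [At Bxs] AB] := ch _ nW.
exists (A, \pi_suspension @` B) => /=.
  by split=> //; exact: suspension_pi_open.
move=> [t' z'] /= [At' [[x' s'] Bx's' <-]].
rewrite suspension_flow_pi.
exact: (AB (t', (x', s'))).
Qed.

End suspension.

Arguments suspension_flow {R X} T f t z.

(* Main.v *)
(** The SFBP, applied to the sections [pi (B x {0})] with B a small ball of X,
    gives finitely many small closed sets covering X whose boundaries have null
    flow boxes.  After disjointification they cut the suspension into closed
    boxes which are small for the metric [d_L], and of which at most 6 meet at a
    point outside a closed null set F; this bound does not depend on L.  Orbits
    spend an arbitrarily small proportion of their time near F: otherwise a
    limit of empirical measures along an ultrafilter would be an invariant
    probability measure charging F.  Bump functions supported near the boxes,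
    evaluated at the times jL with jL < N, thus separate points up to [eps] in
    [d_N], while at every point at most [6 N / L + o(N)] of them are nonzero.
    They map the suspension to a compact subset of a coordinate skeleton of that
    dimension, so that [Widim_eps / N] is asymptotically at most [6 / L], with L
    arbitrarily large. *)
From HB Require Import structures.
From Stdlib Require Import Relation_Operators.
Require Import Defs.
From mathcomp Require Import all_boot all_order all_algebra.
From mathcomp Require Import generic_quotient.
From mathcomp Require Import all_classical all_reals all_analysis.
From mathcomp Require Import measurable_realfun lra zify.

Set Implicit Arguments.
Unset Strict Implicit.
Unset Printing Implicit Defensive.

Import Order.TTheory GRing.Theory Num.Theory.
Import numFieldNormedType.Exports.

Local Open Scope classical_set_scope.
Local Open Scope ring_scope.

(** * Compatible metrics *)

(** The obstacle is that coordinates sample orbits at the discrete times [jL], while SFBP only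
    concerns measures invariant under the whole flow. The bridge is to have [[0,1]F] null, not just
    [F]: a visit to a thin neighbourhood of [F] at time [jL] is followed by a full unit of time near
    [[0,1]F], and these units are disjoint when [L >= 1], so occupation time bounds the number of
    visits. Only the sides of the boxes lie over a null set. Overlaps at tops and bottoms are paid
    for by the multiplicity 6 = 3 * 2: three candidate representatives of a point under the closed
    roof, times two adjacent height slabs. The invariant measure comes from limits on closed sets
    alone, through a content. It need not agree with these limits on closed sets; it suffices that
    an open set has at least the limit value of each closed set inside it. *)

Lemma at_right_witness (R : realType) (P : R -> Prop) :
  (\forall r \near 0^'+, P r) -> exists2 r : R, 0 < r & P r.
Proof.
move=> H; have [r [r0 Pr]] := filter_ex (filterI (nbhs_right_gt 0) H).
by exists r.
Qed.

Section compatible_metric_theory.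
Context (R : realType) (Z : topologicalType) (d : Z -> Z -> R).
Hypothesis hd : compatible_metric d.

Lemma cmetric_ge0 x y : 0 <= d x y.
Proof.
have := cmetric_triangle hd y x x.
by rewrite (cmetric_sym hd y x) cmetricxx//; lra.
Qed.

Lemma nbhs_cmetric_ball x e : 0 < e -> nbhs x [set y | d x y < e].
Proof. by move=> e0; rewrite (cmetric_nbhs hd); exists e. Qed.

Lemma cmetric_ball_subset x U :
  nbhs x U -> exists2 e : R, 0 < e & forall y, d x y < e -> U y.
Proof. by rewrite (cmetric_nbhs hd) => -[e /= e0 eU]; exists e. Qed.

Lemma cmetric_hausdorff : hausdorff_space Z.
Proof.
move=> x y xy; apply: (cmetric_positivity hd); apply/eqP; apply: contraT => dxy.
have d0 : 0 < d x y / 2 by rewrite divr_gt0// lt_def dxy cmetric_ge0.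
have [z [/= xz yz]] := xy _ _ (nbhs_cmetric_ball x d0) (nbhs_cmetric_ball y d0).
by have := cmetric_triangle hd z x y; rewrite (cmetric_sym hd z y); lra.
Qed.

Lemma lipschitz_continuous (h : Z -> R) :
  (forall x y, h x <= h y + d x y) -> continuous h.
Proof.
move=> hlip x; apply/cvgrPdist_lt => e e0.
apply: filterS (nbhs_cmetric_ball x e0) => y /= xy.
have := hlip x y; have := hlip y x; rewrite (cmetric_sym hd y x) => *.
by rewrite ltr_norml; apply/andP; split; lra.
Qed.

(** The near-covering form of compactness, applied to the filter of small positive radii, turns a
    radius found near each point into a uniform one; later uniformity arguments follow the same
    pattern. *)
Lemma cmetric_compact_nbhs (F U : set Z) : compact F -> open U -> F `<=` U ->
  exists2 r : R, 0 < r & forall x y, F x -> d x y < r -> U y.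
Proof.
move=> /compact_near_coveringP cF oU FU.
have [|e e0 He] :=
    @at_right_witness R (fun r => F `<=` fun x => forall y, d x y < r -> U y).
  apply: cF => x Fx.
  have [e e0 eU] := cmetric_ball_subset (open_nbhs_nbhs (conj oU (FU x Fx))).
  have e20 : 0 < e / 2 by rewrite divr_gt0.
  exists ([set x' | d x x' < e / 2], [set r | r < e / 2]) => /=.
    by split; [exact: nbhs_cmetric_ball|exact: nbhs_right_lt].
  move=> [x' r] /= [xx' re] y x'y; apply: eU.
  by have := cmetric_triangle hd x' x y; lra.
by exists e => // x y Fx; exact: He.
Qed.

End compatible_metric_theory.

Lemma compact_uniform_continuous (R : realType) (W Z : topologicalType)
    (dW : W -> W -> R) (d : Z -> Z -> R) (G : R * W -> Z) (b e : R) :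
  compatible_metric dW -> compatible_metric d -> compact [set: W] ->
  continuous G -> 0 < e ->
  exists2 r : R, 0 < r & forall t t' w w', 0 <= t <= b -> `|t - t'| < r ->
    dW w w' < r -> d (G (t, w)) (G (t', w')) < e.
Proof.
move=> hW hd cW cG e0.
have /compact_near_coveringP cK := compact_setX (@segment_compact R 0 b) cW.
have [|r r0 H] := @at_right_witness R (fun r => `[0, b] `*` [set: W] `<=`
    fun p => forall t' w', `|p.1 - t'| < r -> dW p.2 w' < r ->
      d (G p) (G (t', w')) < e).
  apply: cK => -[t w] _.
  have e20 : 0 < e / 2 by rewrite divr_gt0.
  have [[A B] /= [/nbhs_ballP[a /= a0 aA] Bw] AB] :=
    cG (t, w) _ (nbhs_cmetric_ball hd (G (t, w)) e20).
  have [a' a'0 a'B] := cmetric_ball_subset hW Bw.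
  pose c := Num.min a a' / 2.
  have c0 : 0 < c by rewrite divr_gt0// lt_min a0 a'0.
  have ca : c + c <= a by rewrite -splitr ge_min lexx.
  have ca' : c + c <= a' by rewrite -splitr ge_min lexx orbT.
  exists ([set p | `|t - p.1| < c /\ dW w p.2 < c], [set r | r < c]) => /=.
    split; last exact: nbhs_right_lt.
    exists (ball t c, [set w' | dW w w' < c]) => //=.
    by split; [exact: nbhsx_ballx|exact: nbhs_cmetric_ball].
  move=> [[t1 w1] r] /= [[tt1 ww1] rc] t' w' t1t' w1w'.
  have H1 : d (G (t, w)) (G (t1, w1)) < e / 2.
    apply: (AB (t1, w1)); split=> /=; last by apply: a'B; lra.
    by apply: aA; rewrite /ball/=; lra.
  have H2 : d (G (t, w)) (G (t', w')) < e / 2.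
    apply: (AB (t', w')); split=> /=.
      by apply: aA; rewrite /ball/=; have := ler_distD t1 t t'; lra.
    by apply: a'B; have := cmetric_triangle hW w1 w w'; lra.
  have := cmetric_triangle hd (G (t, w)) (G (t1, w1)) (G (t', w')).
  by rewrite (cmetric_sym hd (G (t1, w1)) (G (t, w))); lra.
exists r => //.
move=> t t' w w' tb; apply: (H (t, w)); split=> //=.
Qed.

(** * Covering dimension of cubical skeleta *)

Section cubical_star.
Context (R : realType) (K : topologicalType) (I : finType).
Implicit Types (a : I -> K -> R) (J : {set I}) (m : I -> int).

(* The star of the cube face with free coordinates J: every coordinate in J is
   farther from the integers than every other coordinate. *)
Definition cubical_star a J m : set K := [set x | forall i,
  if i \in J then
    [/\ (m i)%:~R < a i x, a i x < (m i)%:~R + 1 & forall l, l \notin J ->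
      `|a l x - (m l)%:~R| < a i x - (m i)%:~R /\
      `|a l x - (m l)%:~R| < (m i)%:~R + 1 - a i x]
  else `|a i x - (m i)%:~R| < 2^-1].

Lemma near_lt (u v : K -> R) x : {for x, continuous u} ->
  {for x, continuous v} -> u x < v x -> \forall y \near x, u y < v y.
Proof.
move=> cu cv; rewrite -subr_gt0.
have c : {for x, continuous (fun y => v y - u y)} by exact: cvgB.
by move=> /(cvgr_gt _ c); apply: filterS => y; rewrite subr_gt0.
Qed.

Lemma open_cubical_star a J m :
  (forall i, continuous (a i)) -> open (cubical_star a J m).
Proof.
move=> ca; rewrite openE => x xS; rewrite /interior/=.
have cc (c : R) : {for x, continuous (fun=> c : R)} by exact: cvg_cst.
have cl l : {for x, continuous (fun y => a l y - (m l)%:~R)}.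
  by apply: cvgB; [exact: ca|exact: cvg_cst].
have cdist l : {for x, continuous (fun y => `|a l y - (m l)%:~R|)}.
  by apply: cvg_norm; exact: cl.
have cr l : {for x, continuous (fun y => (m l)%:~R + 1 - a l y)}.
  by apply: cvgB; [exact: cvg_cst|exact: ca].
apply: filter_forall => i; have := xS i; case: ifP => iJ; last first.
  by move=> ?; exact: near_lt.
move=> [ml mr H].
have : \forall y \near x, forall l, l \notin J ->
    `|a l y - (m l)%:~R| < a i y - (m i)%:~R /\
    `|a l y - (m l)%:~R| < (m i)%:~R + 1 - a i y.
  apply: filter_forall => l.
  have [lJ|lJ] := boolP (l \in J); first exact: nearW.
  have [h1 h2] := H l lJ.
  exact: filterS2 (near_lt (cdist l) (cl i) h1) (near_lt (cdist l) (cr i) h2).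
apply: filterS3 (near_lt (cc _) (ca i x) ml) (near_lt (ca i x) (cc _) mr).
by move=> y.
Qed.

(** No integer lies strictly between [m] and [m + 1]. *)
Lemma dist_int_gt (s t : R) (m m' : int) :
  s < t - m%:~R -> s < m%:~R + 1 - t -> s < `|t - m'%:~R|.
Proof.
move=> st1 st2; rewrite ltr_normr; have [m'm|mm'] := leP m' m.
  have : m'%:~R <= m%:~R :> R by rewrite ler_int.
  by move=> ?; apply/orP; left; lra.
have : m%:~R + 1 <= m'%:~R :> R by rewrite -intrD1 ler_int lezD1.
by move=> ?; apply/orP; right; lra.
Qed.

(* Both J and J' consist of the coordinates of x farthest from the integers. *)
Lemma cubical_star_inj a J J' m m' x : cubical_star a J m x ->
  cubical_star a J' m' x -> #|J| = #|J'| -> J = J' /\ m = m'.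
Proof.
move=> xS xS' cJ; have JJ' : J = J'.
  apply/eqP; rewrite eqEcard cJ leqnn andbT; apply: contraT.
  move=> /subsetPn[i iJ iJ'].
  have : ~~ (J' \subset J).
    apply: contra iJ' => J'J.
    by have /eqP -> : J' == J by rewrite eqEcard J'J cJ leqnn.
  move=> /subsetPn[l lJ' lJ].
  have := xS i; rewrite iJ => -[_ _ /(_ l lJ)[h1 h2]].
  have := xS' l; rewrite lJ' => -[_ _ /(_ i iJ')[h3 h4]].
  have := lt_trans (dist_int_gt (m' i) h1 h2) (dist_int_gt (m l) h3 h4).
  by rewrite ltxx.
split=> //; apply/funext => i; have := xS i; have := xS' i; rewrite -JJ'.
have close (p q : int) : `|p%:~R - q%:~R| < 1 :> R -> p = q.
  rewrite -intrB -intr_norm (_ : 1 = 1%:~R)// ltr_int => pq.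
  by apply/eqP; rewrite -subr_eq0 -normr_eq0 eq_le normr_ge0 andbT -ltzD1 add0r.
case: ifP => _ => [[h1 h2 _] [h3 h4 _]|].
  by apply: close; rewrite ltr_norml; apply/andP; split; lra.
rewrite !ltr_norml => /andP[h1 h2] /andP[h3 h4].
by apply: close; rewrite ltr_norml; apply/andP; split; lra.
Qed.

(** Integral coordinates are at distance 0 from their floor, which makes every comparison with the
    non-integral ones strict. *)
Lemma cubical_star_cover a x :
  cubical_star a [set i | a i x \isn't a Num.int]%SET
    (fun i => Num.floor (a i x)) x.
Proof.
have itv i := floor_itv (a i x).
move=> i; rewrite inE; case: ifPn => [ai|]; last first.
  by rewrite negbK intrEfloor => /eqP ->; rewrite subrr normr0.
have aix l : a l x \is a Num.int -> `|a l x - (Num.floor (a l x))%:~R| = 0.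
  by rewrite intrEfloor => /eqP ->; rewrite subrr normr0.
have h1 : (Num.floor (a i x))%:~R < a i x.
  by rewrite lt_neqAle -intrEfloor ai /=; have /andP[] := itv i.
have h2 : a i x < (Num.floor (a i x))%:~R + 1.
  by rewrite -intrD1; have /andP[] := itv i.
split=> // l; rewrite inE negbK => /aix ->.
by rewrite !subr_gt0.
Qed.

Lemma cubical_star_small a J m x y : cubical_star a J m x ->
  cubical_star a J m y -> forall i, `|a i x - a i y| < 1.
Proof.
move=> xS yS i; have := xS i; have := yS i.
case: ifP => _ => [[h1 h2 _] [h3 h4 _]|].
  by rewrite ltr_norml; apply/andP; split; lra.
rewrite !ltr_norml => /andP[h1 h2] /andP[h3 h4].
by apply/andP; split; lra.
Qed.

End cubical_star.

(** A Lebesgue number for the sup-distance of coordinate vectors: [K] carries no metric here, and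
    separating coordinates on a compact space stand in for one. *)
Lemma compact_coordinates_lebesgue (R : realType) (K : topologicalType)
    (I : finType) (g : I -> K -> R) (U : set (set K)) :
  compact [set: K] -> (forall i, continuous (g i)) ->
  (forall x y, (forall i, g i x = g i y) -> x = y) -> open_cover U ->
  exists2 r : R, 0 < r & forall x, exists2 A, U A &
    forall y, (forall i, `|g i x - g i y| < r) -> A y.
Proof.
move=> /[dup] cK /compact_near_coveringP ncK cg ginj [oU covU].
have [|r r0 H] := @at_right_witness R (fun r => [set: K] `<=` fun x =>
    exists2 A, U A & forall y, (forall i, `|g i x - g i y| < r) -> A y);
  last by exists r => // x; exact: H.
apply: ncK => x0 _; have [A UA Ax0] : (\bigcup_(A in U) A) x0 by rewrite covU.
have oA := oU _ UA.
have cCA : compact (~` A).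
  rewrite -[~` A]setTI; apply: compact_closedI => //; exact: open_closedC.
have /compact_near_coveringP ncA := cCA.
have [|r r0 H] := @at_right_witness R (fun r => ~` A `<=` fun y =>
    exists i, r <= `|g i x0 - g i y|).
  apply: ncA => y Ay.
  have [i gxy] : exists i, g i x0 <> g i y.
    apply: contrapT => /forallNP H; apply: Ay.
    by rewrite -(ginj x0 y)// => i; exact: contrapT.
  have e0 : 0 < `|g i x0 - g i y| / 2.
    by rewrite divr_gt0// normr_gt0 subr_eq0; exact/eqP.
  exists ([set y' | `|g i y - g i y'| < `|g i x0 - g i y| / 2],
          [set r | r < `|g i x0 - g i y| / 2]) => /=.
    split; last exact: nbhs_right_lt.
    by have /cvgrPdist_lt := cg i y; exact.
  move=> [y' r] /= [h1 h2]; exists i.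
  have := ler_distD (g i y') (g i x0) (g i y).
  by rewrite (distrC (g i y')); lra.
exists ([set x | forall i, `|g i x0 - g i x| < r / 2],
  [set r' | r' < r / 2]) => /=.
  split; last by apply: nbhs_right_lt; rewrite divr_gt0.
  apply: filter_forall => i.
  by have /cvgrPdist_lt := cg i x0; apply; rewrite divr_gt0.
move=> [x r'] /= [xx0 r'r]; exists A => // y xy.
apply: contrapT => /H[i]; have := ler_distD (g i x) (g i x0) (g i y).
by have := xx0 i; have := xy i; lra.
Qed.

(** By [cubical_star_inj] a point lies in at most one star for each cardinality of [J], and [J] can
    be taken among the nonzero coordinates because 0 is an integer. The cardinalities 0 to [n] thus
    give a refinement by stars of multiplicity [n + 1]. *)
Lemma covering_dim_le (R : realType) (K : topologicalType)
    (I : finType) (g : I -> K -> R) (n : nat) :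
  compact [set: K] -> (forall i, continuous (g i)) ->
  (forall x y, (forall i, g i x = g i y) -> x = y) ->
  (forall x, #|[set i | g i x != 0%R]%SET| <= n)%N ->
  (covering_dim K R <= n%:R%:E)%E.
Proof.
move=> cK cg ginj gn; apply: ereal_inf_lbound => /=; exists n.+1; last first.
  by rewrite -natr1 addrK.
move=> U oU; have [r r0 Hr] := compact_coordinates_lebesgue cK cg ginj oU.
(* Two points of a star differ by less than 1 in each [a i], hence by less than [r] in each
   [g i]. *)
pose a i x := r^-1 * g i x.
have ca i : continuous (a i).
  by move=> x; apply: cvgM; [exact: cvg_cst|exact: cg].
have rV0 : 0 < r^-1 by rewrite invr_gt0.
exists [set B | exists Jm : {set I} * (I -> int),
  [/\ (#|Jm.1| <= n)%N, B = cubical_star a Jm.1 Jm.2 & B !=set0]]; split.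
- split; first by move=> _ [[J m] [_ -> _]]; exact: open_cubical_star.
  apply/seteqP; split=> // x _.
  have xS := cubical_star_cover a x; eexists; last exact: xS.
  exists ([set i | a i x \isn't a Num.int]%SET, fun i => Num.floor (a i x)).
  split=> //=; last by exists x.
  apply: leq_trans (gn x); apply: subset_leq_card; apply/fintype.subsetP => i.
  by rewrite !inE; apply: contraNN => /eqP gi; rewrite /a gi mulr0 rpred0.
- move=> _ [[J m] /= [_ -> [x xS]]]; have [A UA xA] := Hr x.
  exists A => // y yS; apply: xA => i.
  have := cubical_star_small xS yS i.
  by rewrite /a -mulrBr normrM gtr0_norm// mulrC ltr_pdivrMr// mul1r.
move=> x; apply/pcard_leP/injfunPex.
(* A set may be a star in several ways; one presentation per set is fixed, and its [#|J|] numbers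
   the stars through [x]. *)
pose is_star B (Jm : {set I} * (I -> int)) :=
  (#|Jm.1| <= n)%N /\ B = cubical_star a Jm.1 Jm.2.
have /choice[F FP] B : exists Jm, (exists Jm', is_star B Jm') -> is_star B Jm.
  have [[Jm H]|nH] := pselect (exists Jm, is_star B Jm); first by exists Jm.
  by exists (finset.set0, fun=> 0).
have {}FP B : (exists Jm : {set I} * (I -> int),
    [/\ (#|Jm.1| <= n)%N, B = cubical_star a Jm.1 Jm.2 & B !=set0]) ->
    is_star B (F B).
  by move=> [Jm [h1 h2 _]]; apply: FP; exists Jm.
exists (fun B => #|(F B).1|).
  by move=> B [/FP[+ _] _] /=; rewrite ltnS.
move=> B B' /set_mem [/FP[_ eB] xB] /set_mem [/FP[_ eB'] xB'].
rewrite eB in xB; rewrite eB' in xB' => cBB'.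
have [e1 e2] := cubical_star_inj xB xB' cBB'.
by rewrite eB eB' e1 e2.
Qed.

(** * Width dimension *)

Lemma continuous_rV (R : realType) (Z : topologicalType) n (G : Z -> 'rV[R]_n) :
  (forall j, continuous (fun z => G z ord0 j)) -> continuous G.
Proof.
move=> cG z U /nbhs_ballP[e /= e0 eU].
have : \forall z' \near z, forall j, ball (G z ord0 j) e (G z' ord0 j).
  by apply: filter_forall => j; have /cvgrPdist_lt := cG j z; exact.
by apply: filterS => z' H; apply: eU; split=> // i j; rewrite (ord1 i).
Qed.

Lemma metrizable_set_type (R : realType) (V : normedModType R) (A : set V) :
  metrizable R (set_type A).
Proof.
exists (fun x y : A => `|\val x - \val y|); split.
- by move=> x; rewrite subrr normr0.
- by move=> x y /normr0_eq0/subr0_eq; exact: val_inj.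
- by move=> x y; rewrite distrC.
- by move=> y x z; exact: ler_distD.
move=> x; apply/seteqP; split=> U.
  move=> /nbhs_ballP[e /= e0 eU]; exists e => // y /= xy; apply: eU.
  by rewrite -initial_ballE/= -ball_normE.
move=> [e /= e0 eU]; apply/nbhs_ballP; exists e => // y.
by rewrite -initial_ballE/= -ball_normE; exact: eU.
Qed.

(** The target is the range of the coordinate map: restricting to it gives compactness and lets the
    bound on nonzero coordinates hold at every point. *)
Lemma widim_le (R : realType) (Z : topologicalType) (I : finType)
    (h : I -> Z -> R) (n : nat) (eps : R) (D : Z -> Z -> R) :
  compact [set: Z] -> (forall i, continuous (h i)) ->
  (forall z, #|[set i | h i z != 0%R]%SET| <= n)%N ->
  (forall z z', (forall i, h i z = h i z') -> D z z' < eps) ->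
  (widim eps D <= n%:R%:E)%E.
Proof.
move=> cZ ch hn hD.
pose G z : 'rV[R]_#|I| := \row_j h (enum_val j) z.
have cG : continuous G.
  apply: continuous_rV => j; rewrite (_ : (fun z => _) = h (enum_val j))//.
  by apply/funext => z; rewrite mxE.
pose K := set_type (range G).
have GK z : G z \in range G by apply/mem_set; exists z.
pose g z : K := exist _ (G z) (GK z).
have cg : continuous g by exact: continuous_comp_initial.
have cK : compact [set: K].
  rewrite (_ : setT = g @` setT); last first.
    apply/seteqP; split=> // -[v vG] _; have [z _ zv] := set_mem vG.
    by exists z => //; exact/val_inj.
  by apply: continuous_compact => //; exact: continuous_subspaceT.
pose c (i : I) (x : K) : R := (\val x) ord0 (enum_rank i).
have cgE i z : c i (g z) = h i z by rewrite /c mxE enum_rankK.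
have gsurj x : exists z, x = g z.
  by case: x => v vG; have [z _ zv] := set_mem vG; exists z; exact/val_inj.
apply: ereal_inf_le; exists (covering_dim K R); last first.
  apply: (covering_dim_le (g := c) cK).
  - move=> i x; apply: (@continuous_comp K 'rV[R]_#|I| R set_val
      (fun M => M ord0 (enum_rank i))).
      exact: initial_continuous.
    exact: coord_continuous.
  - move=> x y xy; apply/val_inj/rowP => j; have := xy (enum_val j).
    by rewrite /c enum_valK.
  - move=> x; have [z ->] := gsurj x; apply: leq_trans (hn z).
    by apply: subset_leq_card; apply/fintype.subsetP => i; rewrite !inE cgE.
exists K; split=> //; first exact: metrizable_set_type.
exists g; split=> // z z' gz; apply: hD => i.
by rewrite -!cgE gz.
Qed.

(** As [Z] may be empty, 0 would not be a valid bound; the -1 disappears after division by [N]. *)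
Lemma widim_geN1 (R : realType) (Z : topologicalType) (eps : R)
    (D : Z -> Z -> R) :
  ((-1)%:E <= widim eps D)%E.
Proof.
apply: le_ereal_inf_tmp => _ [K [_ _ _ ->]].
apply: le_ereal_inf_tmp => _ [n _ <-].
by rewrite lee_fin lerBrDr addNr.
Qed.

(** * The measure of a content on closed sets *)

Section closed_content.
Context (R : realType) (Z : topologicalType) (d : Z -> Z -> R).
Hypotheses (hd : compatible_metric d) (cZ : compact [set: Z]).
Variable m : set Z -> R.
Hypotheses (m_set0 : m set0 = 0) (m_setT : m setT = 1).
Hypothesis m_le : forall A B, closed A -> closed B -> A `<=` B -> m A <= m B.
Hypothesis m_setU : forall A B, closed A -> closed B ->
  m (A `|` B) <= m A + m B.
Hypothesis m_disjoint : forall A B, closed A -> closed B -> A `&` B = set0 ->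
  m A + m B <= m (A `|` B).

(** Together with [outer_content], the classical passage from a content on compact sets to a Borel
    measure. *)
Definition inner_content (U : set Z) : \bar R :=
  ereal_sup [set (m C)%:E | C in [set C | closed C /\ C `<=` U]].

Definition outer_content (A : set Z) : \bar R :=
  ereal_inf [set inner_content U | U in [set U | open U /\ A `<=` U]].

Local Open Scope ereal_scope.

Lemma closed_compact (C : set Z) : closed C -> compact C.
Proof. by move=> cC; rewrite -[C]setTI; exact: compact_closedI. Qed.

Lemma inner_content_ge C U : closed C -> C `<=` U ->
  (m C)%:E <= inner_content U.
Proof. by move=> cC CU; apply: ereal_sup_ubound; exists C. Qed.

Lemma inner_content_ge0 U : 0 <= inner_content U.
Proof. have -> : 0 = (m set0)%:E by rewrite m_set0.
by apply: inner_content_ge => //; exact: closed0. Qed.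

Lemma inner_content_le U V : U `<=` V -> inner_content U <= inner_content V.
Proof.
move=> UV; apply: ge_ereal_sup => _ [C [cC CU] <-].
by apply: inner_content_ge => //; exact: subset_trans UV.
Qed.

Lemma inner_content_le1 U : inner_content U <= 1.
Proof.
apply: ge_ereal_sup => _ [C [cC CU] <-].
have -> : 1 = (m setT)%:E by rewrite m_setT.
rewrite lee_fin.
by apply: m_le => //; exact: closedT.
Qed.

Lemma outer_content_le A U : open U -> A `<=` U ->
  outer_content A <= inner_content U.
Proof. by move=> oU AU; apply: ereal_inf_lbound; exists U. Qed.

Lemma outer_content_ge0 A : 0 <= outer_content A.
Proof. by apply: le_ereal_inf_tmp => _ [U _ <-]; exact: inner_content_ge0. Qed.

Lemma outer_content_fin A : outer_content A \is a fin_num.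
Proof.
rewrite ge0_fin_numE ?outer_content_ge0//.
apply: le_lt_trans (outer_content_le (@openT _) (@subsetT _ A)) _.
exact: le_lt_trans (inner_content_le1 _) (ltry _).
Qed.

Lemma outer_content_open U : open U -> outer_content U = inner_content U.
Proof.
move=> oU; apply/eqP; rewrite eq_le outer_content_le//=.
by apply: le_ereal_inf_tmp => _ [V [oV UV] <-]; exact: inner_content_le.
Qed.

(** [C2] collects the part of [C] near the compact set of points of [C] outside [A], which lies in
    [B]; cutting at half the available radius keeps even the closure of that part inside [B]. *)
Lemma closed_cover2_split C A B : closed C -> open A -> open B ->
  C `<=` A `|` B -> exists C1 C2 : set Z, [/\ closed C1, closed C2, C1 `<=` A,
    C2 `<=` B & C = C1 `|` C2].
Proof.
move=> cC oA oB CAB.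
have cCA : compact (C `\` A).
  by apply: closed_compact; apply: closedI => //; exact: open_closedC.
have CAB' : C `\` A `<=` B by move=> x [/CAB[]].
have [r r0 rB] := cmetric_compact_nbhs hd cCA oB CAB'.
have r20 : (0 < r / 2)%R by rewrite divr_gt0.
pose P := \bigcup_(x in C `\` A) [set y | (d x y < r / 2)%R]°.
have oP : open P by apply: bigcup_open => x _; exact: open_interior.
exists (C `\` P), (C `&` closure P); split.
- by apply: closedI => //; exact: open_closedC.
- by apply: closedI => //; exact: closed_closure.
- move=> x [Cx nPx]; apply: contrapT => nAx; apply: nPx; exists x => //.
  exact: nbhs_cmetric_ball.
- move=> x [Cx /(_ _ (nbhs_cmetric_ball hd x r20))[y [[w [Cw nAw] wy] xy]]].
  apply: (rB w) => //; have /= := interior_subset wy.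
  move: xy => /=; have := cmetric_triangle hd y w x.
  by rewrite (cmetric_sym hd y x); lra.
apply/seteqP; split=> x; last by move=> [[]|[]].
move=> Cx; have [Px|nPx] := pselect (P x); last by left.
by right; split=> //; exact: subset_closure.
Qed.

Lemma closed_content_bigsetU n C (U : nat -> set Z) : closed C ->
  (forall i, open (U i)) -> C `<=` \big[setU/set0]_(i < n) U i ->
  (m C)%:E <= \sum_(i < n) inner_content (U i).
Proof.
elim: n C => [|n IH] C cC oU.
  by rewrite !big_ord0 subset0 => ->; rewrite m_set0.
rewrite !big_ord_recr/= => CU.
have [||C1 [C2 [cC1 cC2 C1U C2U ->]]] := closed_cover2_split cC _ _ CU.
- by elim/big_ind : _ => //; [exact: open0|exact: openU].
- by [].
apply: le_trans (_ : (m C1 + m C2)%:E <= _); first by rewrite lee_fin m_setU.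
by rewrite EFinD leeD ?IH ?inner_content_ge.
Qed.

Lemma inner_content_bigcup (U : nat -> set Z) : (forall i, open (U i)) ->
  inner_content (\bigcup_i U i) <= \sum_(i <oo) inner_content (U i).
Proof.
move=> oU; apply: ge_ereal_sup => _ [C [cC CU] <-].
have [n Cn] : exists n, C `<=` \big[setU/set0]_(i < n) U i.
  (* Near-covering along [\oo]: the partial unions increase to a cover of the compact set [C], so
     one of them contains it. *)
  have /compact_near_coveringP/(_ _ \oo
    (fun n x => (\big[setU/set0]_(i < n) U i) x)) := closed_compact cC.
  case=> [x Cx|n _ nC]; last by exists n; apply: nC => /=.
  have [i _ Uix] := CU x Cx.
  exists (U i, [set n | (i < n)%N]) => /=.
    by split; [exact: open_nbhs_nbhs|exact: nbhs_infty_gt].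
  move=> [y n] /= [Uy ilt]; rewrite -bigcup_mkord; by exists i.
apply: le_trans (closed_content_bigsetU cC oU Cn) _.
rewrite -(big_mkord xpredT (fun i => inner_content (U i))).
by apply: nneseries_lim_ge => i _ _; exact: inner_content_ge0.
Qed.

Lemma outer_content_set0 : outer_content set0 = 0.
Proof.
apply/eqP; rewrite eq_le outer_content_ge0 andbT.
apply: le_trans (outer_content_le open0 (@subset_refl _ _)) _.
apply: ge_ereal_sup => _ [C [_ C0] <-].
by move: C0; rewrite subset0 => ->; rewrite m_set0.
Qed.

Lemma outer_content_sigma_subadditive A F :
  subset_sigma_subadditive outer_content A F.
Proof.
move=> AF; apply/lee_addgt0Pr => e e0.
have e20 n : (0 < e / (2 ^ n.+1)%:R)%R by rewrite divr_gt0// ltr0n expn_gt0.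
have /choice[U UP] : forall n, exists U, [/\ open U, F n `<=` U &
    inner_content U <= outer_content (F n) + (e / (2 ^ n.+1)%:R)%:E].
  move=> n; have [_ [U [oU FU] <-] /ltW ?] :=
    lb_ereal_inf_adherent (e20 n) (outer_content_fin (F n)).
  by exists U.
have oU n : open (U n) by have [] := UP n.
apply: le_trans (epsilon_trick xpredT _ (ltW e0)); last first.
  by move=> n; exact: outer_content_ge0.
apply: le_trans (outer_content_le (bigcup_open _) _) _.
  by move=> n _; exact: (oU n).
  apply: subset_trans AF _; apply: subset_bigcup => n _; by have [] := UP n.
apply: le_trans (inner_content_bigcup oU) _.
apply: lee_nneseries => [n _ _|n _]; first exact: inner_content_ge0.
by have [] := UP n.
Qed.

HB.instance Definition _ := isSubsetOuterMeasure.Build R Z outer_content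
  outer_content_set0 outer_content_ge0 outer_content_sigma_subadditive.

(** Given an open [V] containing the test set, approximate the intersection of [V] and [U] by a
    closed [C], then [V] minus [C], which contains [V] minus [U], by a closed [D]. As [C] and [D]
    are disjoint, [m_disjoint] bounds [m C + m D] by the inner content of [V]. *)
Lemma open_outer_content_caratheodory U : open U ->
  outer_content.-caratheodory U.
Proof.
move=> oU; apply: le_caratheodory_measurable => X.
apply: le_ereal_inf_tmp => _ [V [oV XV] <-].
apply: le_trans (_ : inner_content (V `&` U) + outer_content (V `\` U) <= _).
  apply: leeD; last by apply: le_outer_measure; exact: setSI.
  by apply: outer_content_le; [exact: openI|exact: setSI].
rewrite -leeBrDr ?outer_content_fin//.
apply: ge_ereal_sup => _ [C [cC CVU] <-].
rewrite leeBrDr ?outer_content_fin//.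
have oVC : open (V `\` C) by apply: openI => //; exact: closed_openC.
apply: le_trans (_ : (m C)%:E + inner_content (V `\` C) <= _).
  apply: leeD2l; apply: outer_content_le => // x [Vx nUx]; split=> // Cx.
  by apply: nUx; have [] := CVU _ Cx.
rewrite addeC -leeBrDr//.
apply: ge_ereal_sup => _ [D [cD DVC] <-].
rewrite leeBrDr// addeC; apply: le_trans (_ : (m (C `|` D))%:E <= _).
  rewrite -EFinD lee_fin m_disjoint// -subset0 => x [Cx /DVC[]].
  by [].
apply: inner_content_ge; first exact: closedU.
by move=> x [/CVU[]|/DVC[]].
Qed.

Variable z0 : Z.

Definition content_probability : set (borel z0) -> \bar R := outer_content.

Lemma borel_caratheodory : (measurable : set (set (borel z0))) `<=`
  @caratheodory_measurable R (pointed_at z0) outer_content.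
Proof.
apply: smallest_sub; last by move=> U; exact: open_outer_content_caratheodory.
split; first exact: caratheodory_measurable_set0.
  by move=> A cA; rewrite setTD; exact: caratheodory_measurable_setC.
by move=> F cF; exact: caratheodory_measurable_bigcup.
Qed.

Lemma content_probability_sigma_additive :
  semi_sigma_additive content_probability.
Proof.
move=> F mF tF mUF.
apply: (@caratheodory_measure_sigma_additive R (pointed_at z0)
  outer_content) => //.
  by move=> n; exact: borel_caratheodory.
exact: borel_caratheodory.
Qed.

HB.instance Definition _ := isMeasure.Build _ _ _ content_probability
  outer_content_set0 outer_content_ge0 content_probability_sigma_additive.

Lemma content_probability_setT : content_probability setT = 1.
Proof.
have -> : content_probability setT = inner_content setT.
  by exact: outer_content_open openT.
apply/eqP; rewrite eq_le inner_content_le1/=.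
have -> : 1 = (m setT)%:E by rewrite m_setT.
by apply: inner_content_ge => //; exact: closedT.
Qed.

HB.instance Definition _ := Measure_isProbability.Build _ _ _
  content_probability content_probability_setT.

Lemma content_probability_exists : exists mu : probability (borel z0) R,
  forall A, mu A = outer_content A.
Proof. by exists content_probability. Qed.

End closed_content.

(** * Occupation times *)

Lemma lebesgue_measure_shift (R : realType) (s : R) (A : set R) :
  measurable A ->
  lebesgue_measure ((fun t : R => t + s) @^-1` A) = lebesgue_measure A.
Proof.
move=> mA; have ms : measurable_fun [set: R]
    ((fun t : R => t + s) : R -> measurableTypeR R).
  apply: continuous_measurable_fun => t.
  by apply: cvgD; [exact: cvg_id|exact: cvg_cst].
apply/esym; rewrite -[LHS]/(_) -[RHS]/(pushforward (@lebesgue_measure R)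
  ((fun t : R => t + s) : R -> measurableTypeR R) A).
apply: lebesgue_measure_unique => //= _ [[a b]] _ <-.
rewrite /pushforward (_ : _ @^-1` _ = `]a - s, b - s]%classic).
  rewrite !lebesgue_measure_itv/= !lte_fin ltrD2r; case: ifP => // _.
  by rewrite -!EFinD; congr (_%:E); lra.
apply/seteqP; split=> t /=; rewrite !in_itv/= => /andP[? ?];
  by apply/andP; split; lra.
Qed.

(** Compactness gives a cluster point, and an ultrafilter converges to each of its cluster
    points. *)
Lemma ultra_segment_cvg (R : realType) (T : Type) (G : set_system T)
    (u : T -> R) (a b : R) : UltraFilter G -> (forall k, a <= u k <= b) ->
  cvg (u @ G).
Proof.
move=> UG uab; have : (u @ G) `[a, b]%classic.
  suff -> : (u @ G) `[a, b]%classic = G setT by exact: filterT.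
  by congr (G _); apply/seteqP; split=> // k _ /=; rewrite in_itv/= uab.
move=> /(@segment_compact R a b (u @ G) _)[p [_ clp]].
apply/cvg_ex; exists p => U pU.
have [//|GC] := in_ultra_setVsetC (u @^-1` U) UG.
by have [x [/= nUx Ux]] := clp (~` U) U GC pU.
Qed.

Section occupation.
Context (R : realType) (Z : topologicalType).
Variable phi : R -> Z -> Z.
Hypothesis hphi : is_flow phi.

Lemma flow0 z : phi 0 z = z. Proof. by have [] := hphi. Qed.

Lemma flowD s t z : phi (s + t) z = phi s (phi t z).
Proof. by have [] := hphi. Qed.

Lemma continuous_flow : continuous (fun p : R * Z => phi p.1 p.2).
Proof. by have [] := hphi. Qed.

Lemma continuous_flow_time z : continuous (phi^~ z).
Proof.
move=> t; apply: (@continuous_comp _ _ _ (fun t => (t, z))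
  (fun p : R * Z => phi p.1 p.2)); last exact: continuous_flow.
have c1 : (fun t : R => t) @ t --> t by exact: cvg_id.
have c2 : (fun=> z) @ t --> z by exact: cvg_cst.
exact: (cvg_pair c1 c2).
Qed.

Lemma continuous_flow_space t : continuous (phi t).
Proof.
move=> z; apply: (@continuous_comp _ _ _ (fun z => (t, z))
  (fun p : R * Z => phi p.1 p.2)); last exact: continuous_flow.
have c1 : (fun=> t) @ z --> t by exact: cvg_cst.
have c2 : (fun z : Z => z) @ z --> z by exact: cvg_id.
exact: (cvg_pair c1 c2).
Qed.

Lemma flowNK t : cancel (phi (- t)) (phi t).
Proof. by move=> z; rewrite -flowD subrr flow0. Qed.

Lemma closed_sweep (d : Z -> Z -> R) a b (E : set Z) : compatible_metric d ->
  compact [set: Z] -> closed E -> closed (sweep phi a b E).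
Proof.
move=> hd cZ cE; rewrite (_ : sweep phi a b E =
    (fun p : R * Z => phi p.1 p.2) @` (`[a, b] `*` E)).
  apply: (compact_closed (cmetric_hausdorff hd)).
  apply: continuous_compact.
    by apply: continuous_subspaceT; exact: continuous_flow.
  by apply: compact_setX; [exact: segment_compact|exact: (closed_compact cZ)].
apply/seteqP; split=> [_ [t tb [z Ez <-]]|_ [[t z] [/= tb Ez] <-]].
  by exists (t, z).
by exists t => //; exists z.
Qed.

Definition visits (A : set Z) (z : Z) : set R := [set t | A (phi t z)].

Lemma open_visits_measurable A z : open A -> measurable (visits A z).
Proof.
move=> oA; apply: open_measurable.
by have /continuousP := @continuous_flow_time z; exact.
Qed.

Lemma closed_visits_measurable A z : closed A -> measurable (visits A z).
Proof.
move=> cA; apply: closed_measurable.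
by apply: preimage_closed => // t _; exact: continuous_flow_time.
Qed.

Local Notation leb := (@lebesgue_measure R).

Definition occupation (N : R) (z : Z) (A : set Z) : R :=
  fine (leb (`[0, N] `&` visits A z)).

Lemma occupation_fin (N : R) z A : measurable (visits A z) ->
  leb (`[0, N] `&` visits A z) \is a fin_num.
Proof.
move=> mA.
have : (leb (`[0%R, N] `&` visits A z) <= leb (`[0%R, N]%classic : set R))%E.
  by apply: le_measure; rewrite ?inE//; exact: measurableI.
move=> le; rewrite ge0_fin_numE//; apply: le_lt_trans le _.
by rewrite lebesgue_measure_itv/=; case: ifP => _; rewrite -?EFinB ltry.
Qed.

Lemma occupation_ge0 N z A : 0 <= occupation N z A.
Proof. exact: fine_ge0. Qed.

Lemma occupation_setT N z : 0 <= N -> occupation N z setT = N.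
Proof.
move=> N0; rewrite /occupation (_ : visits setT z = setT)// setIT.
rewrite lebesgue_measure_itv/= lte_fin; case: ltP => /= ?; last by lra.
by rewrite subr0.
Qed.

Lemma occupation_le N z A B : measurable (visits A z) ->
  measurable (visits B z) -> A `<=` B -> occupation N z A <= occupation N z B.
Proof.
move=> mA mB AB; apply: fine_le; [exact: occupation_fin..|].
apply: le_measure; rewrite ?inE; [exact: measurableI..|].
by apply: setIS => t; exact: AB.
Qed.

Lemma occupation_setU N z A B : measurable (visits A z) ->
  measurable (visits B z) ->
  occupation N z (A `|` B) <= occupation N z A + occupation N z B.
Proof.
move=> mA mB; rewrite /occupation -fineD ?occupation_fin//.
have mI C : measurable (visits C z) -> measurable (`[0, N] `&` visits C z).
  by move=> mC; exact: measurableI.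
have mAB : measurable (visits (A `|` B) z) by exact: measurableU.
apply: fine_le; rewrite ?fin_numD ?occupation_fin//.
rewrite (_ : `[0, N] `&` visits (A `|` B) z =
  (`[0, N] `&` visits A z) `|` (`[0, N] `&` visits B z));
  last by rewrite -setIUr.
by apply: measureU2; exact: mI.
Qed.

Lemma occupation_disjoint N z A B : measurable (visits A z) ->
  measurable (visits B z) -> A `&` B = set0 ->
  occupation N z (A `|` B) = occupation N z A + occupation N z B.
Proof.
move=> mA mB AB; rewrite /occupation -fineD ?occupation_fin//; congr fine.
have mI C : measurable (visits C z) -> measurable (`[0, N] `&` visits C z).
  by move=> mC; exact: measurableI.
rewrite (_ : `[0, N] `&` visits (A `|` B) z =
  (`[0, N] `&` visits A z) `|` (`[0, N] `&` visits B z));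
  last by rewrite -setIUr.
apply: measureU; [exact: mI..|].
apply/seteqP; split=> // t [[_ At] [_ Bt]].
suff : (A `&` B) (phi t z) by rewrite AB.
by split.
Qed.

(** The translated window [[s, N + s]] sticks out of [[0, N]] within an interval of length [|s|]. *)
Lemma occupation_shift N z A s : measurable (visits A z) ->
  occupation N z (phi s @^-1` A) <= occupation N z A + `|s|.
Proof.
move=> mA.
have [a [b [ab ab_s sub]]] : exists a b : R, [/\ a <= b, b - a = `|s| &
    forall t, 0 <= t - s <= N -> 0 <= t <= N \/ a <= t <= b].
  have [s0|s0] := leP 0 s.
    exists N, (N + s); rewrite ger0_norm//; split; [lra|lra|] => t /andP[h1 h2].
    by have [tN|tN] := leP t N; [left|right]; apply/andP; split; lra.
  exists s, 0; rewrite ltr0_norm//; split; [lra|lra|] => t /andP[h1 h2].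
  by have [tN|tN] := leP 0 t; [left|right]; apply/andP; split; lra.
pose B := (`[s, N + s]%classic : set R) `&` visits A z.
have mB : measurable B by exact: measurableI.
have eqB : `[0, N] `&` visits (phi s @^-1` A) z = (fun t => t + s) @^-1` B.
  apply/seteqP; split=> t /=; rewrite /B/= /visits/= !in_itv/= (addrC t) flowD.
    by move=> [/andP[h1 h2] h]; split=> //; apply/andP; split; lra.
  by move=> [/andP[h1 h2] h]; split=> //; apply/andP; split; lra.
have leab : leb (`[a, b]%classic : set R) = `|s|%:E.
  rewrite lebesgue_measure_itv/= lte_fin -ab_s -EFinB.
  by case: ltP => // ?; congr (_%:E); lra.
have mI : measurable (`[0, N] `&` visits A z) by exact: measurableI.
have le : (leb B <= leb (`[0%R, N] `&` visits A z) + `|s|%R%:E)%E.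
  rewrite -leab; apply: le_trans (measureU2 _ _ _) => //.
  apply: le_measure; rewrite ?inE//; first exact: measurableU.
  move=> t [/=]; rewrite in_itv/= => /andP[h1 h2] h.
  have [|h3|h3] := sub t; first by apply/andP; split; lra.
    by left; split=> //=; rewrite in_itv.
  by right; rewrite /= in_itv.
rewrite /occupation eqB lebesgue_measure_shift//.
rewrite -[`|s|]/(fine `|s|%:E) -fineD ?occupation_fin//.
apply: fine_le => //; last by rewrite fin_numD occupation_fin.
rewrite ge0_fin_numE//; apply: le_lt_trans le _.
by rewrite -ge0_fin_numE ?adde_ge0// fin_numD occupation_fin.
Qed.

End occupation.
Local Open Scope ring_scope.

(** * Limits of empirical measures along an ultrafilter, and their flow invariance *)

Section empirical_limit.
Context (R : realType) (Z : topologicalType) (d : Z -> Z -> R).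
Hypotheses (hd : compatible_metric d) (cZ : compact [set: Z]).
Variable phi : R -> Z -> Z.
Hypothesis hphi : is_flow phi.
Variables (N : nat -> R) (z : nat -> Z) (G : set_system nat).
Hypotheses (N_ge : forall k, k.+1%:R <= N k) (UG : UltraFilter G).
Hypothesis ooG : \oo `<=` G.

Definition empirical (A : set Z) (k : nat) : R :=
  occupation phi (N k) (z k) A / N k.

Definition empirical_limit (A : set Z) : R := lim (empirical A @ G).

Lemma time_gt0 k : 0 < N k.
Proof. exact: lt_le_trans (N_ge k). Qed.

Let mC (A : set Z) k : closed A -> measurable (visits phi A (z k)).
Proof. exact: closed_visits_measurable. Qed.

Lemma empirical_cvg A : closed A -> cvg (empirical A @ G).
Proof.
move=> cA; apply: (@ultra_segment_cvg _ _ _ _ 0 1) => k.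
rewrite /empirical divr_ge0 ?occupation_ge0 ?(ltW (time_gt0 k))//=.
rewrite ler_pdivrMr ?time_gt0// mul1r.
rewrite -[leRHS](@occupation_setT _ _ phi _ (z k)) ?(ltW (time_gt0 k))//.
by apply: occupation_le => //; apply: mC => //; exact: closedT.
Qed.

Lemma empirical_limit_setT : empirical_limit setT = 1.
Proof.
rewrite /empirical_limit (_ : empirical setT = fun=> 1) ?lim_cst//.
apply/funext => k; rewrite /empirical occupation_setT ?(ltW (time_gt0 k))//.
by rewrite divff// gt_eqF// time_gt0.
Qed.

Lemma empirical_limit_set0 : empirical_limit set0 = 0.
Proof.
rewrite /empirical_limit (_ : empirical set0 = fun=> 0) ?lim_cst//.
apply/funext => k; rewrite /empirical /occupation (_ : visits _ _ _ = set0)//.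
by rewrite setI0 measure0 mul0r.
Qed.

Lemma empirical_limit_le A B : closed A -> closed B -> A `<=` B ->
  empirical_limit A <= empirical_limit B.
Proof.
move=> cA cB AB; apply: ler_lim; [exact: empirical_cvg..|].
apply: nearW => k; rewrite ler_pM2r ?invr_gt0 ?time_gt0//.
by apply: occupation_le => //; exact: mC.
Qed.

Lemma empirical_limit_setU A B : closed A -> closed B ->
  empirical_limit (A `|` B) <= empirical_limit A + empirical_limit B.
Proof.
move=> cA cB; have [vA vB] := (empirical_cvg cA, empirical_cvg cB).
rewrite /empirical_limit -limD//; apply: ler_lim.
- by apply: empirical_cvg; exact: closedU.
- exact: is_cvgD.
apply: nearW => k; rewrite /= /empirical -mulrDl.
rewrite ler_pM2r ?invr_gt0 ?time_gt0//.
by apply: occupation_setU => //; exact: mC.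
Qed.

Lemma empirical_limit_disjoint A B : closed A -> closed B -> A `&` B = set0 ->
  empirical_limit A + empirical_limit B <= empirical_limit (A `|` B).
Proof.
move=> cA cB AB; have [vA vB] := (empirical_cvg cA, empirical_cvg cB).
rewrite /empirical_limit -limD//; apply: ler_lim.
- exact: is_cvgD.
- by apply: empirical_cvg; exact: closedU.
apply: nearW => k; rewrite /= /empirical -mulrDl.
rewrite ler_pM2r ?invr_gt0 ?time_gt0//.
by rewrite occupation_disjoint//; exact: mC.
Qed.

Lemma closed_flow_preimage s A : closed A -> closed (phi s @^-1` A).
Proof.
by move=> cA; apply: preimage_closed => // x _; exact: continuous_flow_space.
Qed.

(** The shift changes the occupation by at most [|s|], which is negligible against
    [N k >= k + 1]. *)
Lemma empirical_limit_shift_le s A : closed A ->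
  empirical_limit (phi s @^-1` A) <= empirical_limit A.
Proof.
move=> cA; have cs := @closed_flow_preimage s A cA.
apply/ler_addgt0Pr => e e0; rewrite /empirical_limit.
have vA := empirical_cvg cA.
have ve : cvg ((cst e : nat -> R) @ G) by apply: cvgP; exact: cvg_cst.
have -> : lim (empirical A @ G) + e = lim ((empirical A + cst e) @ G).
  by rewrite limD// lim_cst.
apply: ler_lim; [exact: empirical_cvg|exact: is_cvgD|].
have : G [set k | `|s| / e < k%:R].
  by apply: ooG; exact: nbhs_infty_gtr.
apply: filterS => k /= sk.
have -> : (empirical A + cst e) k =
    (occupation phi (N k) (z k) A + e * N k) / N k.
  by rewrite mulrDl mulfK// gt_eqF// time_gt0.
rewrite /empirical ler_pM2r ?invr_gt0 ?time_gt0//.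
apply: le_trans (occupation_shift hphi _ _ (mC k cA)) _.
rewrite lerD2l mulrC -ler_pdivrMr// (le_trans (ltW sk))//.
by apply: le_trans (N_ge k); rewrite ler_nat.
Qed.

Lemma empirical_limit_shift s A : closed A ->
  empirical_limit (phi s @^-1` A) = empirical_limit A.
Proof.
move=> cA; apply/eqP; rewrite eq_le empirical_limit_shift_le//=.
have := empirical_limit_shift_le (- s) (@closed_flow_preimage s A cA).
by congr (empirical_limit _ <= _); apply/seteqP; split=> x /=; rewrite flowNK.
Qed.

(** Closed and open sets are stable under preimages by the flow, so invariance passes from closed
    sets to the inner content and then to the outer one. *)
Lemma outer_content_flow_le t (A : set Z) :
  (outer_content empirical_limit (phi t @^-1` A) <=
   outer_content empirical_limit A)%E.
Proof.
apply: le_ereal_inf_tmp => _ [U [oU AU] <-].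
have oV : open (phi t @^-1` U).
  by have /continuousP := @continuous_flow_space _ _ _ hphi t; exact.
have AV : phi t @^-1` A `<=` phi t @^-1` U by move=> x; exact: AU.
apply: le_trans (outer_content_le _ oV AV) _.
apply: ge_ereal_sup => _ [C [cC CV] <-].
rewrite -(empirical_limit_shift (- t) cC).
apply: inner_content_ge; first exact: closed_flow_preimage.
by move=> x /= /CV /=; rewrite flowNK.
Qed.

Lemma outer_content_flow t (A : set Z) :
  outer_content empirical_limit (phi t @^-1` A) =
  outer_content empirical_limit A.
Proof.
apply/eqP; rewrite eq_le outer_content_flow_le/=.
have := outer_content_flow_le (- t) (phi t @^-1` A).
by congr (outer_content _ _ <= _)%E; apply/seteqP; split=> x /=; rewrite flowNK.
Qed.

(** Outer regularity is built into [outer_content]: a Borel set of measure 0 containing [F] has an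
    open neighbourhood of small inner content, which bounds the limit on closed subsets. *)
Lemma null_empirical_limit F e : flow_null phi F -> 0 < e -> exists U : set Z,
  [/\ open U, F `<=` U &
      forall C, closed C -> C `<=` U -> empirical_limit C < e].
Proof.
move=> nF e0.
have [mu muE] := content_probability_exists hd cZ empirical_limit_set0
  empirical_limit_setT empirical_limit_le empirical_limit_setU
  empirical_limit_disjoint (z 0%N).
have inv : invariant_measure phi mu.
  by move=> t A mA; rewrite !muE; exact: outer_content_flow.
have [B [mB muB FB]] := nF _ mu inv.
have : (outer_content empirical_limit B < e%:E)%E by rewrite -muE muB lte_fin.
move=> /ereal_inf_lt[_ [U [oU BU] <-] Ue]; exists U; split=> //.
  exact: subset_trans BU.
move=> C cC CU; rewrite -lte_fin; apply: le_lt_trans Ue.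
exact: inner_content_ge.
Qed.

End empirical_limit.

(** The point is uniformity in [z]. If it fails, times [N k] and points [z k] with excess occupation
    of shrinking neighbourhoods of [F] produce an empirical limit of at least [e] on a closed set
    inside [U]. *)
Lemma flow_null_occupation (R : realType) (Z : topologicalType)
    (d : Z -> Z -> R) (phi : R -> Z -> Z) (F : set Z) (e : R) :
  compatible_metric d -> compact [set: Z] -> is_flow phi -> closed F ->
  flow_null phi F -> 0 < e ->
  exists O, [/\ open O, F `<=` O & exists N0 : R, forall N z, N0 <= N ->
    occupation phi N z O <= e * N].
Proof.
move=> hd cZ hphi cF nF e0; apply: contrapT => /forallNP H.
pose O k : set Z := \bigcup_(x in F) [set y | d x y < k.+1%:R^-1]°.
have k0 k : 0 < (k.+1%:R^-1 : R) by rewrite invr_gt0.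
have oO k : open (O k) by apply: bigcup_open => x _; exact: open_interior.
have FO k : F `<=` O k by move=> x Fx; exists x => //; exact: nbhs_cmetric_ball.
have OO j k : (j <= k)%N -> O k `<=` O j.
  move=> jk x [y Fy]; rewrite /interior/= => xy; exists y => //.
  apply: filterS xy => w /= /lt_le_trans; apply.
  by rewrite lef_pV2 ?posrE// ler_nat.
have /choice[Nz HNz] : forall k, exists Nz : R * Z, k.+1%:R <= Nz.1 /\
    e * Nz.1 < occupation phi Nz.1 Nz.2 (O k).
  move=> k; apply: contrapT => /forallNP Hk; apply: (H (O k)); split=> //.
  exists k.+1%:R => N z kN; rewrite leNgt; apply/negP => ?.
  by apply: (Hk (N, z)).
pose N k := (Nz k).1; pose z k := (Nz k).2.
have N_ge k : k.+1%:R <= N k by have [] := HNz k.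
have [G [UG ooG]] := ultraFilterLemma (_ : ProperFilter \oo).
have [U [oU FU Ue]] :=
  null_empirical_limit hd cZ hphi z N_ge UG ooG nF e0.
have [r r0 rU] := cmetric_compact_nbhs hd (closed_compact cZ cF) oU FU.
(* A point of the closure of [O j] is within two radii [1/(j+1) < r/2] of [F]. The closure is used
   because [U] controls the limit on closed sets only. *)
have [j jr] : exists j : nat, 2 / r < j.+1%:R.
  by exists (Num.truncn (2 / r)); exact: truncnS_gt.
have cOU : closure (O j) `<=` U.
  move=> x clx; have [y [[w Fw /interior_subset /= wy] /= xy]] :=
    clx _ (nbhs_cmetric_ball hd x (k0 j)).
  apply: (rU w) => //; have := cmetric_triangle hd y w x.
  rewrite (cmetric_sym hd y x); have : j.+1%:R^-1 < r / 2.
    by rewrite -[ltRHS]invrK invf_div ltf_pV2 ?posrE// divr_gt0.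
  by move: wy xy; set c := _^-1 => wy xy *; lra.
have := Ue _ (@closed_closure _ (O j)) cOU.
rewrite ltNge => /negP; apply.
have vO : cvg (empirical phi N z (closure (O j)) @ G).
  by apply: empirical_cvg => //; exact: closed_closure.
apply: (limr_ge vO).
have : G [set k | (j <= k)%N] by apply: ooG; exact: nbhs_infty_ge.
apply: filterS => k /= jk; rewrite /empirical ler_pdivlMr ?(time_gt0 N_ge)//.
apply: ltW; apply: lt_le_trans (_ : occupation phi (N k) (z k) (O k) <= _).
  by have [] := HNz k.
apply: occupation_le.
- exact: open_visits_measurable.
- by apply: closed_visits_measurable => //; exact: closed_closure.
by apply: subset_trans (@subset_closure _ _); exact: OO.
Qed.

(** * Suspension flows *)

(** Asking for [r <= f x <= r^-1] lets one small [r] provide both bounds. *)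
Lemma compact_pos_bounds (R : realType) (X : topologicalType) (f : X -> R) :
  compact [set: X] -> continuous f -> (forall x, 0 < f x) ->
  exists c M : R, 0 < c /\ forall x, c <= f x <= M.
Proof.
move=> /compact_near_coveringP cX cf f0.
have [|r r0 H] := @at_right_witness R (fun r => [set: X] `<=`
    fun x => r <= f x <= r^-1).
  apply: cX => x _.
  have fx0 : 0 < f x / 2 by rewrite divr_gt0.
  have fx1 : 0 < (f x + f x / 2)^-1 by rewrite invr_gt0 addr_gt0.
  exists ([set y | `|f x - f y| < f x / 2],
    [set r | 0 < r] `&` ([set r | r < f x / 2] `&`
      [set r | r < (f x + f x / 2)^-1])) => /=.
    split; first by have /cvgrPdist_lt := cf x; exact.
    apply: filterI; first exact: nbhs_right_gt.
    by apply: filterI; apply: nbhs_right_lt.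
  move=> [y r] /= [+ [r0 [h1 h2]]]; rewrite ltr_norml => /andP[h3 h4].
  apply/andP; split; first lra.
  rewrite -[f y]invrK lef_pV2 ?posrE ?invr_gt0//.
  apply: le_trans (ltW h2) _; rewrite lef_pV2 ?posrE ?addr_gt0//; lra.
by exists r, r^-1; split=> [|x]; [|exact: H].
Qed.

Section suspension_representatives.
Local Open Scope quotient_scope.
Context (R : realType) (X : topologicalType) (T : X -> X) (f : X -> R).
Hypotheses (hT : homeomorphism T).
Variable c : R.
Hypotheses (c_gt0 : 0 < c) (f_ge : forall x, c <= f x).

Local Notation Z := (suspension T f).
Local Notation P := (\pi_Z).

Implicit Types p q : X * R.

(** The generator of the integer action whose orbits are the fibres of the projection. *)
Definition shift_down (p : X * R) : X * R := (T p.1, p.2 - f p.1).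

Lemma pi_shift_down p : P (shift_down p) = P p.
Proof.
apply/esym/suspension_piP/rst_step; exists p.1, (p.2 - f p.1).
by rewrite subrK -surjective_pairing.
Qed.

Lemma shift_down_inj : injective shift_down.
Proof.
have [_ [T' [_ TK _]]] := hT.
move=> [x s] [y t] [/(can_inj TK) -> +]; rewrite /=.
by move=> /addIr ->.
Qed.

(** As [shift_down] is injective, a zigzag of steps cancels to a run in one direction. *)
Lemma pi_eq_iter p q : P p = P q -> exists n,
  iter n shift_down p = q \/ iter n shift_down q = p.
Proof.
move=> /suspension_piP; elim=> {p q}.
- move=> _ _ [x [s [-> ->]]]; exists 1%N; left.
  by rewrite /= /shift_down /= addrK.
- by move=> p; exists 0%N; left.
- by move=> p q _ [n [h|h]]; exists n; [right|left].
have inj n : injective (iter n shift_down).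
  by elim: n => // n IH p q /= /shift_down_inj/IH.
move=> p q r _ [n [pq|qp]] _ [m [qr|rq]].
- by exists (m + n)%N; left; rewrite iterD pq.
- have [nm|/ltnW mn] := leqP n m.
    exists (m - n)%N; right; apply: (inj n).
    by rewrite -iterD subnKC// pq.
  exists (n - m)%N; left; apply: (inj m).
  by rewrite -iterD subnKC// pq.
- have [nm|/ltnW mn] := leqP n m.
    by exists (m - n)%N; left; rewrite -qp -iterD subnK.
  by exists (n - m)%N; right; rewrite -qr -iterD subnK.
- by exists (n + m)%N; right; rewrite iterD rq.
Qed.

Lemma iter_shift_down_le n p : (iter n shift_down p).2 <= p.2 - c *+ n.
Proof.
elim: n => [|n IH] /=; first by rewrite subr0.
by rewrite mulrSr; have := f_ge (iter n shift_down p).1; lra.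
Qed.

(** Every application of [shift_down] lowers the height by at least [c]. *)
Lemma pi_inj_close p q : P p = P q -> `|p.2 - q.2| < c -> p = q.
Proof.
move=> /pi_eq_iter[[|n] [E|E]] //.
  have := iter_shift_down_le n.+1 p; rewrite E mulrS ltr_norml => {E}.
  by have := mulrn_wge0 n (ltW c_gt0) => ? ? /andP[? ?]; exfalso; lra.
have := iter_shift_down_le n.+1 q; rewrite E mulrS ltr_norml => {E}.
by have := mulrn_wge0 n (ltW c_gt0) => ? ? /andP[? ?]; exfalso; lra.
Qed.

(** Closed at both ends, so that boxes cut from it can be compact; the cost is that a point may have
    several representatives. *)
Definition fundamental_domain : set (X * R) := [set p | 0 <= p.2 <= f p.1].

(** The first shift brings the height to at most 0, the second strictly below. *)
Lemma iter2_fundamental_domain n p : fundamental_domain p ->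
  fundamental_domain (iter n.+2 shift_down p) -> False.
Proof.
move=> /andP[p1 p2] /andP[+ _].
have := iter_shift_down_le n.+1 (shift_down p).
rewrite -iterSr mulrS [(shift_down p).2]/=; set y := (iter _ _ _).2.
move=> a b; have : c + c *+ n <= 0.
  apply: (@le_trans _ _ (p.2 - f p.1)); last by rewrite subr_le0.
  by rewrite -subr_ge0 (le_trans b).
by rewrite leNgt ltr_wpDr// mulrn_wge0// ltW.
Qed.

Lemma pi_eq_fundamental_domain p q : fundamental_domain p ->
  fundamental_domain q -> P p = P q ->
  [\/ q = p, q = shift_down p | p = shift_down q].
Proof.
move=> Dp Dq /pi_eq_iter[[|[|n]] [E|E]].
- exact: Or31.
- exact: Or31.
- exact: Or32.
- exact: Or33.
- by exfalso; apply: (@iter2_fundamental_domain n p) => //; rewrite E.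
- by exfalso; apply: (@iter2_fundamental_domain n q) => //; rewrite E.
Qed.

Lemma fundamental_domain_exists z : exists p, fundamental_domain p /\ P p = z.
Proof.
rewrite -[z]reprK; case: (repr z) => x s {z}.
have [_ [T' [_ TK T'K]]] := hT.
have bound (t : R) : exists n, t < c *+ n.
  exists (Num.truncn (t / c)).+1; rewrite -mulr_natr -ltr_pdivrMl// mulrC.
  exact: truncnS_gt.
have [s0|s0] := leP 0 s.
  have [n] := bound s; elim: n x s s0 => [|n IH] x s s0.
    by rewrite mulr0n; lra.
  rewrite mulrSr => sn; have [sf|sf] := leP s (f x).
    by exists (x, s); split=> //; apply/andP.
  have [||p [Dp Ep]] := IH (T x) (s - f x); [lra|have := f_ge x; lra|].
  by exists p; split=> //; rewrite Ep -[RHS]pi_shift_down.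
have [n] := bound (- s); elim: n x s s0 => [|n IH] x s s0.
  by rewrite mulr0n; lra.
rewrite mulrSr => sn; have E : shift_down (T' x, s + f (T' x)) = (x, s).
  by rewrite /shift_down /= T'K addrK.
have [sf|sf] := leP 0 (s + f (T' x)).
  exists (T' x, s + f (T' x)); split.
    by apply/andP; split=> //=; lra.
  by rewrite -pi_shift_down E.
have [||p [Dp Ep]] := IH (T' x) (s + f (T' x)); [lra|have := f_ge (T' x); lra|].
by exists p; split=> //; rewrite Ep -pi_shift_down E.
Qed.

End suspension_representatives.

(** * Flow-null sets *)

Section flow_null_theory.
Context (R : realType) (Z : topologicalType) (phi : R -> Z -> Z).
Hypothesis hphi : is_flow phi.

Lemma flow_nullS A B : A `<=` B -> flow_null phi B -> flow_null phi A.
Proof.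
move=> AB nB z0 mu inv; have [C [mC muC BC]] := nB z0 mu inv.
by exists C; split=> //; exact: subset_trans BC.
Qed.

Lemma flow_null_bigcup (F : nat -> set Z) :
  (forall k, flow_null phi (F k)) -> flow_null phi (\bigcup_k F k).
Proof. by move=> nF z0 mu inv; apply: negligible_bigcup => k; exact: nF. Qed.

Lemma flow_preimage_measurable (z0 : Z) t (A : set (borel z0)) :
  measurable A -> measurable (phi t @^-1` A : set (borel z0)).
Proof.
move=> mA; pose S : set (set (borel z0)) :=
  [set B | measurable (phi t @^-1` B : set (borel z0))].
suff : S A by [].
apply: (smallest_sub _ _ mA).
  split.
  - by rewrite /S/= preimage_set0; exact: measurable0.
  - move=> B SB; rewrite /S/= setTD preimage_setC; exact: (measurableC SB).
  - move=> F SF; rewrite /S/= preimage_bigcup.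
    by apply: bigcup_measurable => k _; exact: SF.
move=> U oU; rewrite /S/=; apply: sub_sigma_algebra.
by have /continuousP := continuous_flow_space hphi (t := t); exact.
Qed.

Lemma flow_null_preimage t A : flow_null phi A -> flow_null phi (phi t @^-1` A).
Proof.
move=> nA z0 mu inv; have [B [mB muB AB]] := nA z0 mu inv.
exists (phi t @^-1` B); split.
- exact: flow_preimage_measurable.
- by rewrite inv.
- by move=> x; exact: AB.
Qed.

(** Every [t >= 0] is within [eta] of a multiple [eta *+ k], so countably many flow translates of
    the null box suffice. *)
Lemma flow_null_sweep eta b A : 0 < eta ->
  flow_null phi (sweep phi (- eta) eta A) -> flow_null phi (sweep phi 0 b A).
Proof.
move=> eta0 nA; apply: (@flow_nullS _ (\bigcup_k
   (phi (- (eta *+ k)) @^-1` sweep phi (- eta) eta A))); last first.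
  by apply: flow_null_bigcup => k; exact: flow_null_preimage.
move=> _ [t /= + [x Ax <-]]; rewrite in_itv/= => /andP[t0 _].
exists (Num.truncn (t / eta)) => //=.
have /andP[] := truncn_itv (divr_ge0 t0 (ltW eta0)).
set k := Num.truncn _ => h1 h2.
exists (t - eta *+ k); last by exists x => //; rewrite -flowD// addrC.
rewrite /= in_itv/= -mulr_natr.
move: h1 h2; rewrite ler_pdivlMr// ltr_pdivrMr// -natr1 mulrDl mul1r.
by rewrite (mulrC eta) => h1 h2; apply/andP; split; lra.
Qed.

End flow_null_theory.

(** * Small sections of the suspension *)

(** Near-covering along the filter of finite sequences, directed by inclusion, extracts a finite
    subcover. *)
Lemma compact_seq_cover (X : topologicalType) (A : X -> set X) :
  compact [set: X] -> (forall x, nbhs x (A x)) ->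
  exists s : seq X, forall x, exists2 y, y \in s & A y x.
Proof.
move=> /compact_near_coveringP cX nA.
pose F : set_system (seq X) :=
  filter_from setT (fun s0 : seq X => [set s : seq X | {subset s0 <= s}]).
have FF : Filter F.
  apply: filter_from_filter; first by exists [::].
  move=> s t _ _; exists (s ++ t) => // u /= stu.
  by split=> x xs; apply: stu; rewrite mem_cat xs ?orbT.
have [|s0 _ H] := cX _ F (fun s x => exists2 y, y \in s & A y x) FF.
  move=> x _; exists (A x, [set s | x \in s]) => /=.
    split=> //; exists [:: x] => // s; apply; exact: mem_head.
  by move=> [x' s] /= [Axx' xs]; exists x.
by exists s0 => x; apply: (H s0).
Qed.

Section suspension_sections.
Local Open Scope quotient_scope.
Context (R : realType) (X : topologicalType) (T : X -> X) (f : X -> R).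
Hypotheses (hT : homeomorphism T) (cf : continuous f).
Hypothesis cX : compact [set: X].
Variables (c M : R) (dX : X -> X -> R).
Hypotheses (c_gt0 : 0 < c) (f_bounds : forall x, c <= f x <= M).
Hypothesis hdX : compatible_metric dX.

Local Notation Z := (suspension T f).
Local Notation P := (\pi_Z).
Local Notation phi := (suspension_flow T f).

Variable d : Z -> Z -> R.
Hypothesis hd : compatible_metric d.

Let f_ge x : c <= f x. Proof. by have /andP[] := f_bounds x. Qed.
Let f_le x : f x <= M. Proof. by have /andP[] := f_bounds x. Qed.
Let flow_phi : is_flow phi. Proof. exact: suspension_flow_is_flow. Qed.

Lemma continuous_pi : continuous (P : X * R -> Z).
Proof. exact: pi_continuous. Qed.

Lemma continuous_pi_section s : continuous (fun x : X => P (x, s)).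
Proof.
move=> x; apply: (@continuous_comp _ _ _ (fun x : X => (x, s))
  (fun p => P p)); last exact: continuous_pi.
have c1 : (fun x : X => x) @ x --> x by exact: cvg_id.
have c2 : (fun=> s) @ x --> s by exact: cvg_cst.
exact: (cvg_pair c1 c2).
Qed.

Lemma compact_pi_image K : compact K -> compact (P @` K).
Proof.
move=> cK; apply: continuous_compact => //.
by apply: continuous_subspaceT; exact: continuous_pi.
Qed.

Lemma suspension_compact : compact [set: Z].
Proof.
rewrite (_ : setT = P @` ([set: X] `*` `[0, M])).
  apply: compact_pi_image.
  by apply: compact_setX; [exact: cX|exact: segment_compact].
apply/seteqP; split=> // z _.
have [[x s] [/andP[/= s0 sf] <-]] := fundamental_domain_exists hT c_gt0 f_ge z.
by exists (x, s) => //; split=> //=; rewrite in_itv/= s0 (le_trans sf (f_le x)).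
Qed.

Lemma suspension_closed (K : set Z) : compact K -> closed K.
Proof. by move=> cK; have := compact_closed (cmetric_hausdorff hd) cK. Qed.

Definition base_section (B : set X) : set Z := [set P (x, 0) | x in B].

Lemma base_section_cross eta B : 0 < eta -> eta + eta < c ->
  cross_section phi eta (base_section B).
Proof.
move=> eta0 etac; split=> // -[t z] [t' z'] /set_mem[/= + [x _ <-]].
move=> + /set_mem[/= + [x' _ <-]].
rewrite !in_itv/= => /andP[t1 t2] /andP[t1' t2'].
rewrite !suspension_flow_pi !add0r => /(pi_inj_close hT c_gt0 f_ge)/=.
have : `|t - t'| < c by rewrite ltr_norml; apply/andP; split; lra.
by move=> tt' /(_ tt')[-> ->].
Qed.

Lemma base_section_interior eta B x : 0 < eta -> nbhs x B ->
  flow_interior phi eta (base_section B) (P (x, 0)).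
Proof.
move=> eta0 xB; split; last by exists x => //; exact: nbhs_singleton.
have nV : nbhs (x, 0 : R) (B `*` ball (0 : R) eta).
  by exists (B, ball (0 : R) eta) => //; split=> //; exact: nbhsx_ballx.
rewrite /interior/=; apply: filterS (suspension_pi_open hT cf nV).
move=> _ [[y t] /= [By +] <-]; rewrite /ball/= sub0r normrN => /ltW.
rewrite ler_norml => t_eta; exists t; first by rewrite /= in_itv.
by exists (P (y, 0)); [exists y|rewrite suspension_flow_pi add0r].
Qed.

(** A point [P (x, 0)] near [P (y, 0)] is reached from [S] in time less than [c], and [S] is also at
    height 0, so [pi_inj_close] puts [P (x, 0)] in [S] itself. *)
Lemma flow_interior_trace eta (S : set Z) y : 0 < eta -> eta + eta < c ->
  S `<=` base_section setT -> flow_interior phi eta S (P (y, 0)) ->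
  nbhs y [set x | S (P (x, 0))].
Proof.
move=> eta0 etac SB [/= yS _].
have : \forall x \near y, sweep phi (- eta) eta S (P (x, 0)) :=
  continuous_pi_section yS.
apply: filterS => x /= [t + [s Ss]]; rewrite /= in_itv/= => /andP[t1 t2].
have [x' _ sx'] := SB _ Ss; rewrite -sx' suspension_flow_pi add0r => Ex.
have t_c : `|t - 0| < c by rewrite ltr_norml; apply/andP; split; lra.
have [<- _] := pi_inj_close hT c_gt0 f_ge Ex t_c.
by rewrite sx'.
Qed.

Hypothesis sfbp : SFBP phi.

(** [A] is the trace at height 0 of the section given by SFBP, and [E] its flow boundary;
    [flow_interior_trace] turns flow interior into interior in [X]. *)
Lemma small_section (r : R) (x : X) : 0 < r -> exists (A : set X) (E : set Z),
  [/\ closed A, closed E, nbhs x A, forall y, A y -> dX x y <= r &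
      (forall y, A y -> ~ A° y -> E (P (y, 0))) /\
      forall b, flow_null phi (sweep phi 0 b E)].
Proof.
move=> r0; pose B := [set y | dX x y <= r].
have cdx : continuous (dX x).
  apply: (lipschitz_continuous hdX) => y z.
  by rewrite (cmetric_sym hdX y z); exact: cmetric_triangle.
have cB : closed B.
  rewrite (_ : B = dX x @^-1` [set s | s <= r]) //.
  apply: preimage_closed => [y _|]; first exact: cdx.
  exact: closed_le.
have cS' : closed (base_section B).
  have cpB : compact B by exact: (closed_compact cX cB).
  apply: suspension_closed; apply: continuous_compact => //.
  by apply: continuous_subspaceT; exact: continuous_pi_section.
have eta0 : 0 < c / 3 by rewrite divr_gt0.
have etac : c / 3 + c / 3 < c by lra.
have xB : nbhs x B by apply: filterS (nbhs_cmetric_ball hdX x r0) => y /ltW.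
have [_ /(_ (P (x, 0)) (c / 3) (base_section B) cS')] := sfbp.
move=> /(_ (base_section_cross _ eta0 etac) (base_section_interior eta0 xB)).
move=> [S [cS SS' Sx nS]].
have SB : S `<=` base_section setT by move=> s /SS'[y _ <-]; exists y.
exists [set y | S (P (y, 0))], (flow_boundary phi (c / 3) S); split.
- by apply: preimage_closed => // y _; exact: continuous_pi_section.
- rewrite (_ : flow_boundary _ _ _ =
      S `&` ~` (sweep phi (- (c / 3)) (c / 3) S)°).
    by apply: closedI => //; apply: open_closedC; exact: open_interior.
  rewrite /flow_boundary/flow_interior -(iffLR (closure_id S) cS).
  apply/seteqP; split=> z [Sz nz]; split=> //; first by move=> iz; apply: nz.
  by move=> [].
- exact: flow_interior_trace SB Sx.
- move=> y /= /SS'[y' By' /(pi_inj_close hT c_gt0 f_ge)/=].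
  by rewrite subrr normr0 => /(_ c_gt0)[<-].
split; last by move=> b; exact: flow_null_sweep nS.
move=> y Sy nSy; split; first exact: subset_closure.
by move=> iy; apply: nSy; exact: flow_interior_trace SB iy.
Qed.

Lemma small_section_cover (r : R) : 0 < r ->
  exists (p : nat) (A : 'I_p -> set X) (E : set Z),
  [/\ forall i, closed (A i), closed E, forall x, exists i, A i x,
      forall i x y, A i x -> A i y -> dX x y < r &
      (forall i x, A i x -> ~ (A i)° x -> E (P (x, 0))) /\
      forall b, flow_null phi (sweep phi 0 b E)].
Proof.
move=> r0; have r30 : 0 < r / 3 by rewrite divr_gt0.
have /choice[AE HAE] : forall x, exists AE : set X * set Z,
  [/\ closed AE.1, closed AE.2, nbhs x AE.1,
      forall y, AE.1 y -> dX x y <= r / 3 &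
      (forall y, AE.1 y -> ~ (AE.1)° y -> AE.2 (P (y, 0))) /\
      forall b, flow_null phi (sweep phi 0 b AE.2)].
  by move=> x; have [A [E H]] := small_section x r30; exists (A, E).
have [|D Dcov] := @compact_seq_cover X (fun x => (AE x).1) cX.
  by move=> x; have [] := HAE x.
pose a i := (AE (tnth (in_tuple D) i)).
exists _, (fun i => (a i).1), (\bigcup_(i in setT) (a i).2); split.
- by move=> i; have [] := HAE (tnth (in_tuple D) i).
- apply: closed_bigcup => [|i _]; first exact: finite_finset.
  by have [] := HAE (tnth (in_tuple D) i).
- move=> x; have [y /= yD xy] := Dcov x.
  have /tnthP[i yi] : y \in in_tuple D by [].
  by exists i; rewrite /a -yi.
- move=> i x y; rewrite /a; have [_ _ _ H _] := HAE (tnth (in_tuple D) i).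
  move: (tnth _ _) H => w H /H h1 /H h2.
  by have := cmetric_triangle hdX w x y; rewrite (cmetric_sym hdX x w); lra.
split=> [i x Ax nAx|b].
  by exists i => //; have [_ _ _ _ [+ _]] := HAE (tnth (in_tuple D) i); exact.
(* [flow_null_bigcup] takes a union over [nat], so indices beyond the finite range receive the empty
   set. *)
apply: (@flow_nullS _ _ _ _ (\bigcup_k
  (if insub k is Some i then sweep phi 0 b (a i).2 else set0))).
  move=> _ [t tb [z [i _ az] <-]]; exists i => //.
  by rewrite valK; exists t => //; exists z.
apply: flow_null_bigcup => k; case: insubP => [i _ _|_].
  by have [_ _ _ _ [_]] := HAE (tnth (in_tuple D) i); exact.
move=> z0 mu inv; exact: negligible_set0.
Qed.

End suspension_sections.

(** * A closed cover of small multiplicity *)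

(** Two slabs containing the same height are equal or adjacent, and adjacent indices differ in
    parity. *)
Lemma itv_same_parity (R : realType) (tau s : R) (k l : nat) : 0 < tau ->
  tau *+ k <= s <= tau *+ k.+1 -> tau *+ l <= s <= tau *+ l.+1 ->
  odd k = odd l -> k = l.
Proof.
move=> tau0 /andP[k1 k2] /andP[l1 l2] okl.
have kl : (k <= l.+1)%N by have := le_trans k1 l2; rewrite ler_pMn2l.
have lk : (l <= k.+1)%N by have := le_trans l1 k2; rewrite ler_pMn2l.
by lia.
Qed.

(** The closure keeps the pieces closed; they can then overlap only at boundary points of some
    [A k]. *)
Definition disjointified (X : topologicalType) (p : nat) (A : 'I_p -> set X)
    (i : 'I_p) : set X :=
  closure (A i `\` \bigcup_(j in [set j : 'I_p | (j < i)%N]) A j).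

Section disjointified.
Context (X : topologicalType) (p : nat) (A : 'I_p -> set X).
Hypothesis cA : forall i, closed (A i).

Lemma disjointified_sub i : disjointified A i `<=` A i.
Proof.
have cAi : closed (A i) by exact: cA.
rewrite [X in _ `<=` X](iffLR (closure_id _) cAi).
by apply: closureS; exact: subDsetl.
Qed.

Lemma disjointified_cover x :
  (exists i, A i x) -> exists i, disjointified A i x.
Proof.
move=> [i Ai].
have exP : exists n, [exists j : 'I_p, (val j == n) && `[< A j x >]].
  by exists (val i); apply/existsP; exists i; rewrite eqxx; exact/asboolP.
have [n /existsP[j /andP[/eqP jn /asboolP Aj]] nmin] := ex_minnP exP.
exists j; apply: subset_closure; split=> // -[k /= kj Ak].
have : (n <= k)%N.
  by apply: nmin; apply/existsP; exists k; rewrite eqxx; exact/asboolP.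
by rewrite -jn leqNgt kj.
Qed.

Lemma disjointified_disjoint (i j : 'I_p) x : (A i)° x -> (i < j)%N ->
  ~ disjointified A j x.
Proof.
move=> Ai ij /(_ _ Ai)[y [[_ nA] Ay]]; apply: nA.
by exists i.
Qed.

Lemma disjointified_uniq (i j : 'I_p) x : (forall k, A k x -> (A k)° x) ->
  disjointified A i x -> disjointified A j x -> i = j.
Proof.
move=> Ax xi xj; case: (ltngtP i j) => [ij|ji|/val_inj//].
  by have := disjointified_disjoint (Ax _ (disjointified_sub xi)) ij xj.
by have := disjointified_disjoint (Ax _ (disjointified_sub xj)) ji xi.
Qed.

End disjointified.

Section suspension_closed_cover.
Local Open Scope quotient_scope.
Context (R : realType) (X : topologicalType) (T : X -> X) (f : X -> R).
Hypotheses (hT : homeomorphism T) (cf : continuous f).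
Hypothesis cX : compact [set: X].
Variables (c M : R) (dX : X -> X -> R).
Hypotheses (c_gt0 : 0 < c) (f_bounds : forall x, c <= f x <= M).
Hypothesis hdX : compatible_metric dX.

Local Notation Z := (suspension T f).
Local Notation P := (\pi_Z).
Local Notation phi := (suspension_flow T f).

Variable d : Z -> Z -> R.
Hypothesis hd : compatible_metric d.
Hypothesis sfbp : SFBP phi.

Let f_ge x : c <= f x. Proof. by have /andP[] := f_bounds x. Qed.
Let f_le x : f x <= M. Proof. by have /andP[] := f_bounds x. Qed.
Let flow_phi : is_flow phi. Proof. exact: suspension_flow_is_flow. Qed.

Lemma compact_piece (B : set X) (u v : R) : closed B ->
  compact ((B `*` `[u, v]) `&` [set q : X * R | q.2 <= f q.1]).
Proof.
move=> cB; apply: compact_closedI.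
  apply: compact_setX; last exact: segment_compact.
  exact: (closed_compact cX cB).
rewrite (_ : mkset _ = (fun q : X * R => f q.1 - q.2) @^-1` [set s | 0 <= s]).
  apply: preimage_closed => [q _|]; last exact: closed_ge.
  have c1 : (fun q : X * R => f q.1) @ q --> f q.1.
    by apply: (@continuous_comp _ _ _ fst f); [exact: cvg_fst|exact: cf].
  have c2 : (fun q : X * R => q.2) @ q --> q.2 by exact: cvg_snd.
  exact: (cvgB c1 c2).
by apply/seteqP; split=> q /=; rewrite subr_ge0.
Qed.

(** For a box hit by [z], [key] records which of three possible representatives of [z] it contains
    and the parity of its slab. Off [F] the key determines the box, whence 6, whatever [e] and [b]
    are. *)
Lemma suspension_closed_cover (e b : R) : 0 < e ->
  exists (V : finType) (B : V -> set Z) (F : set Z),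
    [/\ closed F, flow_null phi (sweep phi 0 1 F),
        forall z, exists v, B v z,
        forall v z z', B v z -> B v z' ->
          forall t, 0 <= t <= b -> d (phi t z) (phi t z') < e &
        (forall v, closed (B v)) /\
        forall z, ~ F z -> (#|[set v | `[< B v z >]]%SET| <= 6)%N].
Proof.
move=> e0; have cZ := suspension_compact hT cX c_gt0 f_bounds.
pose G (q : R * X) : Z := P (q.2, q.1).
have cG : continuous G.
  move=> q; apply: (@continuous_comp _ _ _ (fun q : R * X => (q.2, q.1))
    (fun p => P p)).
    have c1 : (fun q : R * X => q.2) @ q --> q.2 by exact: cvg_snd.
    have c2 : (fun q : R * X => q.1) @ q --> q.1 by exact: cvg_fst.
    exact: (cvg_pair c1 c2).
  exact: continuous_pi.
(* Heights up to [M] plus flow times up to [b]. *)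
have [r r0 Gr] := compact_uniform_continuous (M + b) hdX hd cX cG e0.
have [p [A [E [cA cE covA Ar [AE nE]]]]] :=
  small_section_cover hT cf cX c_gt0 f_bounds hdX hd sfbp r0.
pose tau := r / 2; have tau0 : 0 < tau by rewrite divr_gt0.
pose q := (Num.truncn (M / tau)).+1.
pose piece (v : 'I_p * 'I_q) : set (X * R) :=
  (disjointified A v.1 `*` `[tau *+ v.2, tau *+ v.2.+1]) `&`
  [set q : X * R | q.2 <= f q.1].
have piece_dom v w : piece v w -> fundamental_domain f w.
  move=> [[_ /=]]; rewrite in_itv/= => /andP[h _] wf; apply/andP; split=> //.
  by apply: le_trans h; rewrite mulrn_wge0// ltW.
(* [F] carries the bad base set [E] through all heights under the roof. *)
exists ('I_p * 'I_q)%type, (fun v => P @` piece v), (sweep phi 0 M E); split.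
- by apply: (@closed_sweep _ _ _ flow_phi d).
- apply: flow_nullS (nE (M + 1)) => _ [t tb [_ [s sb [z Ez <-]] <-]].
  exists (t + s); last by exists z => //; rewrite flowD.
  move: tb sb; rewrite /= !in_itv/= => /andP[? ?] /andP[? ?].
  by apply/andP; split; lra.
- move=> z; have [[x s] [Dxs <-]] := fundamental_domain_exists hT c_gt0 f_ge z.
  have /andP[/= s0 sf] := Dxs.
  have [i xi] := disjointified_cover (covA x).
  have kq : (Num.truncn (s / tau) < q)%N.
    rewrite ltnS; apply: le_truncn; rewrite ler_pM2r ?invr_gt0//.
    exact: le_trans sf (f_le x).
  exists (i, Ordinal kq), (x, s) => //; split=> //; split=> //=.
  have /andP[h1 h2] := truncn_itv (divr_ge0 s0 (ltW tau0)).
  rewrite in_itv/= -!(mulr_natl tau) -ler_pdivlMr// h1/=.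
  by rewrite -ler_pdivrMr// ltW.
- move=> v _ _ [[x s] [/= [xi sk] sf] <-] [[y u] [/= [yi uk] uf] <-] t tb.
  rewrite !suspension_flow_pi; apply: (Gr (s + t) (u + t) x y).
  + move: sk tb; rewrite in_itv/= => /andP[h1 h2] /andP[h3 h4].
    have := f_le x; have := mulrn_wge0 v.2 (ltW tau0); move: sf => /= sf.
    by move=> ? ?; apply/andP; split; lra.
  + move: sk uk; rewrite !in_itv/= mulrS => /andP[h1 h2] /andP[h3 h4].
    rewrite ltr_norml /tau in h1 h2 h3 h4 *.
    by apply/andP; split; lra.
  + by apply: (Ar v.1); apply: disjointified_sub.
split=> [v|z nFz].
  apply: (suspension_closed hd); apply: compact_pi_image.
  by apply: compact_piece; exact: closed_closure.
have [w0 [Dw0 Pw0]] := fundamental_domain_exists hT c_gt0 f_ge z.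
have /choice[rep repP] : forall v, exists w, (P @` piece v) z ->
    piece v w /\ P w = z.
  move=> v; have [[w vw wz]|nv] := pselect ((P @` piece v) z).
    by exists w.
  by exists w0.
(* For a box that is hit, index 2 means [w0 = shift_down (rep v)], from which injectivity recovers
   [rep v]. *)
pose key v : 'I_3 * bool := (if rep v == w0 then inord 0
  else if rep v == shift_down T f w0 then inord 1 else inord 2, odd v.2).
have -> : 6%N = #|{: 'I_3 * bool}| by rewrite card_prod card_ord card_bool.
pose hit := [set v | `[< (P @` piece v) z >]]%SET.
apply: (leq_trans _ (max_card (mem [set key v | v in hit]%SET))).
rewrite card_in_imset// => v v'; rewrite !inE => hv hv' keyE.
have [pv Pv] := repP _ hv; have [pv' Pv'] := repP _ hv'.
have repE : rep v = rep v'.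
  have := pi_eq_fundamental_domain hT c_gt0 f_ge Dw0 (piece_dom _ _ pv).
  have := pi_eq_fundamental_domain hT c_gt0 f_ge Dw0 (piece_dom _ _ pv').
  rewrite Pw0 Pv Pv' => /(_ erefl) h' /(_ erefl) h.
  move: keyE; rewrite /key => -[+ _].
  have [->|n1] := eqVneq (rep v) w0; have [->|n2] := eqVneq (rep v') w0 => //.
  - by case: ifP => _ /(congr1 val); rewrite /= !inordK.
  - by case: ifP => _ /(congr1 val); rewrite /= !inordK.
  have [->|n3] := eqVneq (rep v) (shift_down T f w0);
    have [->|n4] := eqVneq (rep v') (shift_down T f w0) => //.
  - by move=> /(congr1 val); rewrite /= !inordK.
  - by move=> /(congr1 val); rewrite /= !inordK.
  move=> _; case: h => [/eqP|/eqP|h]; rewrite ?(negPf n1) ?(negPf n3)//.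
  case: h' => [/eqP|/eqP|h']; rewrite ?(negPf n2) ?(negPf n4)//.
  by apply: (shift_down_inj (f := f) hT); rewrite -h -h'.
rewrite -repE in pv'; have /andP[s0 sf] := piece_dom _ _ pv.
move: pv pv' Pv => [[vi vk] _] [[vi' vk'] _] Pv.
have okl : odd v.2 = odd v'.2 by case: keyE.
move: vk vk' => /=; rewrite !in_itv/= => vk vk'.
have k_eq : v.2 = v'.2 by apply: val_inj; exact: itv_same_parity vk vk' okl.
(* If the base point were in some [A k] but not in its interior, it would lie in [E], and flowing it
   up to height [(rep v).2] would put [z] in [F]. *)
have i_eq : v.1 = v'.1.
  apply: disjointified_uniq vi vi' => // k Ak; apply: contrapT => nAk.
  apply: nFz; exists (rep v).2.
    by rewrite /= in_itv/= s0 (le_trans sf (f_le _)).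
  exists (P ((rep v).1, 0)); first exact: AE nAk.
  by rewrite suspension_flow_pi add0r -surjective_pairing.
by rewrite [v]surjective_pairing [v']surjective_pairing i_eq k_eq.
Qed.

End suspension_closed_cover.

(** * Coordinates and visit counts *)

Section bump.
Context (R : realType) (Z : topologicalType) (d : Z -> Z -> R).
Hypothesis hd : compatible_metric d.
Variables (rho : R) (B : set Z).
Hypothesis rho_gt0 : 0 < rho.

(* The supremum of the empty set is 0, so that the bump of the empty set
   vanishes. *)
Definition metric_bump (z : Z) : R :=
  sup [set Num.max 0 (rho - d z b) | b in B].

Lemma metric_bump_has_ubound z :
  has_ubound [set Num.max 0 (rho - d z b) | b in B].
Proof.
exists rho => _ [b _ <-]; rewrite ge_max ltW//=.
by have := cmetric_ge0 hd z b; lra.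
Qed.

Lemma metric_bump_ge z b : B b -> rho - d z b <= metric_bump z.
Proof.
move=> Bb; apply: le_trans (_ : Num.max 0 (rho - d z b) <= _).
  by rewrite le_max lexx orbT.
by apply: ub_le_sup; [exact: metric_bump_has_ubound|exists b].
Qed.

Lemma metric_bump_ge0 z : 0 <= metric_bump z.
Proof.
have [[b Bb]|B0] := pselect (B !=set0).
  apply: le_trans (_ : Num.max 0 (rho - d z b) <= _).
    by rewrite le_max lexx.
  by apply: ub_le_sup; [exact: metric_bump_has_ubound|exists b].
rewrite /metric_bump (_ : [set _ | _ in _] = set0) ?sup0//.
by apply/seteqP; split=> // x' [b Bb _]; case: B0; exists b.
Qed.

Lemma metric_bump_le z x : 0 <= x -> (forall b, B b -> rho - d z b <= x) ->
  metric_bump z <= x.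
Proof.
move=> x0 Bx; have [[b Bb]|B0] := pselect (B !=set0).
  apply: ge_sup; first by exists (Num.max 0 (rho - d z b)); exists b.
  by move=> _ [b' Bb' <-]; rewrite ge_max x0 Bx.
rewrite /metric_bump (_ : [set _ | _ in _] = set0) ?sup0//.
by apply/seteqP; split=> // x' [b Bb _]; case: B0; exists b.
Qed.

Lemma metric_bump_neq0 z : B z -> metric_bump z != 0.
Proof.
move=> Bz; rewrite gt_eqF//; have := metric_bump_ge z Bz.
by rewrite (cmetricxx hd) subr0; exact: lt_le_trans.
Qed.

Lemma metric_bump_support z :
  metric_bump z != 0 -> exists2 b, B b & d z b < rho.
Proof.
apply: contraNP => H; rewrite eq_le metric_bump_ge0 andbT.
apply: metric_bump_le => // b Bb; rewrite subr_le0 leNgt; apply/negP => ?.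
by apply: H; exists b.
Qed.

Lemma continuous_metric_bump : continuous metric_bump.
Proof.
apply: (lipschitz_continuous hd) => x y; apply: metric_bump_le.
  by rewrite addr_ge0 ?metric_bump_ge0// (cmetric_ge0 hd).
move=> b Bb; have := metric_bump_ge y Bb; have := cmetric_triangle hd x y b.
by rewrite (cmetric_sym hd y x); lra.
Qed.

End bump.

(** A closed box that misses a point misses a ball around it, so a small swelling does not raise the
    multiplicity locally; compactness of the complement of [W] makes [rho] uniform. *)
Lemma swelling_multiplicity (R : realType) (Z : topologicalType)
    (d : Z -> Z -> R) (V : finType) (B : V -> set Z) (W : set Z) (m : nat) :
  compatible_metric d -> compact [set: Z] -> (forall v, closed (B v)) ->
  open W -> (forall z, ~ W z -> #|[set v | `[< B v z >]]%SET| <= m)%N ->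
  exists2 rho : R, 0 < rho & forall z, ~ W z ->
    (#|[set v | `[< exists2 b, B v b & (d z b < rho)%R >]]%SET| <= m)%N.
Proof.
move=> hd cZ cB oW mW.
have /compact_near_coveringP cW : compact (~` W).
  by apply: (closed_compact cZ); exact: open_closedC.
have [|r r0 H] := @at_right_witness R (fun r => ~` W `<=` fun z =>
    (#|[set v | `[< exists2 b, B v b & (d z b < r)%R >]]%SET| <= m)%N);
  last by exists r.
apply: cW => z nWz.
have : \forall r \near 0^'+, forall v, ~ B v z ->
    forall b, d z b < r + r -> ~ B v b.
  apply: filter_forall => v; have [Bz|nBz] := pselect (B v z).
    exact: nearW.
  have : nbhs z (~` B v).
    by apply: open_nbhs_nbhs; split=> //; exact: closed_openC.
  move=> /(cmetric_ball_subset hd)[e e0 eB].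
  have e20 : 0 < e / 2 by rewrite divr_gt0.
  apply: filterS (nbhs_right_lt e20) => r re _ b zb; apply: eB; lra.
move=> H; have [r r0 Hr] := at_right_witness H.
exists ([set y | d z y < r], [set r' | r' < r]) => /=.
  by split; [exact: nbhs_cmetric_ball|exact: nbhs_right_lt].
move=> [y r'] /= [zy r'r]; apply: leq_trans (mW z nWz).
apply: subset_leq_card; apply/fintype.subsetP => v; rewrite !inE.
move=> [b Bb yb]; apply: contrapT => nB.
by apply: (Hr v nB b) => //; have := cmetric_triangle hd y z b; lra.
Qed.

Section visit_count.
Context (R : realType) (Z : topologicalType) (phi : R -> Z -> Z).
Hypothesis hphi : is_flow phi.

(** Each visit to [W] at time [L *+ j] keeps the orbit in [O] for the next unit of time, and these
    units do not overlap because [1 <= L]. *)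
Lemma visit_count_le (W O : set Z) (L : R) (n : nat) (z : Z) : open O ->
  1 <= L -> (forall x t, W x -> 0 <= t <= 1 -> O (phi t x)) ->
  (\sum_(j < n) `[< W (phi (L *+ j) z) >])%:R <= occupation phi (L *+ n) z O.
Proof.
move=> oO L1 WO; have mO := open_visits_measurable hphi z oO.
elim: n => [|n IH]; first by rewrite big_ord0; exact: occupation_ge0.
rewrite big_ord_recr /= natrD.
have mI N : measurable (`[0, N] `&` visits phi O z) by exact: measurableI.
have fin N := @occupation_fin _ _ phi N z O mO.
have L0 : 0 <= L by lra.
have Ln0 : 0 <= L *+ n by rewrite mulrn_wge0.
have sub N : L *+ n <= N -> `[0, L *+ n] `<=` `[0, N]%classic.
  by move=> nN t /=; rewrite !in_itv/= => /andP[-> /le_trans]; exact.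
have nS : L *+ n + 1 <= L *+ n.+1 by rewrite mulrSr lerD2l.
case: asboolP => [Wn|_] /=; last first.
  rewrite addr0 (le_trans IH)//; apply: fine_le => //.
  apply: le_measure; rewrite ?inE; [exact: mI..|].
  by apply: setSI; apply: sub; lra.
apply: le_trans (lerD IH (lexx _)) _.
rewrite -[1%:R]/(fine (1%:E : \bar R)) -fineD//.
apply: fine_le; [by rewrite fin_numD fin|by []|].
(* Open on the left, hence disjoint from [[0, L *+ n]]. *)
have <- : lebesgue_measure (`]L *+ n, L *+ n + 1]%classic : set R) = 1%:E.
  rewrite lebesgue_measure_itv/= lte_fin ltrDl ltr01 -EFinB.
  by congr (_%:E); lra.
rewrite -measureU; [|exact: mI|by []|].
  apply: le_measure; rewrite ?inE; [|exact: mI|].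
    by apply: measurableU; [exact: mI|].
  move=> t [[tn vt]|/=].
    by split=> //; apply: sub tn; lra.
  rewrite in_itv/= => /andP[t1 t2]; split.
    by rewrite /= in_itv/=; apply/andP; split; lra.
  rewrite /visits/= -(subrK (L *+ n) t) flowD//; apply: WO => //.
  by apply/andP; split; lra.
apply/seteqP; split=> // t [[/= + _]].
rewrite !in_itv/= => /andP[_ h1] /andP[h2 _].
by move: h2; rewrite ltNge h1.
Qed.

End visit_count.

Lemma card_pairs_le (V : finType) (n m : nat) (A : V -> 'I_n -> bool)
    (bad : pred 'I_n) :
  (forall j, ~~ bad j -> #|[set v | A v j]%SET| <= m)%N ->
  (#|[set p : V * 'I_n | A p.1 p.2]%SET| <=
    m * n + #|V| * \sum_(j < n) bad j)%N.
Proof.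
move=> Am; rewrite -sum1_card (partition_big snd xpredT)//=.
apply: leq_trans (_ : \sum_(j < n) (m + #|V| * bad j) <= _)%N; last first.
  by rewrite big_split/= sum_nat_const card_ord mulnC big_distrr.
apply: leq_sum => j _.
apply: leq_trans (_ : #|[set v | A v j]%SET| <= _)%N; last first.
  case: (boolP (bad j)) => bj; last by rewrite muln0 addn0 Am.
  by rewrite muln1 (leq_trans (max_card _))// leq_addl.
have inj_j : injective (fun v : V => (v, j)) by move=> v w [].
rewrite sum1dep_card -[leqRHS](card_imset _ inj_j).
apply: subset_leq_card; apply/fintype.subsetP => -[v k]; rewrite !inE/=.
by move=> /andP[Avk /eqP kj]; apply/imsetP; exists v; rewrite ?inE -?kj.
Qed.

Lemma cvge0_near (R : realType) (T : Type) (F : set_system T)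
    (u : T -> \bar R) :
  Filter F ->
  (forall e : R, 0 < e -> \forall x \near F, ((- e)%:E <= u x <= e%:E)%E) ->
  u @ F --> 0%E.
Proof.
move=> FF H; apply/fine_cvgP; split.
  apply: filterS (H 1 ltr01) => x /andP[h1 h2].
  by rewrite fin_real// (lt_le_trans (ltNyr _) h1) (le_lt_trans h2 (ltry _)).
apply/cvgrPdist_le => e e0; apply: filterS (H e e0) => x /andP[h1 h2].
rewrite sub0r normrN ler_norml /=.
have ux : u x \is a fin_num.
  by rewrite fin_real// (lt_le_trans (ltNyr _) h1) (le_lt_trans h2 (ltry _)).
by rewrite -!lee_fin fineK// h1 h2.
Qed.

(** * Mean dimension *)

(** Strict bounds at each time would only give a weak one for the supremum, hence [e / 2]. *)
Lemma flow_metric_lt (R : realType) (Z : topologicalType) (phi : R -> Z -> Z)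
    (d : Z -> Z -> R) (L N e : R) (n : nat) z z' : is_flow phi ->
  0 < L -> 0 <= N -> N < L *+ n -> 0 < e ->
  (forall j, (j < n)%N -> forall t, 0 <= t <= L ->
    d (phi t (phi (L *+ j) z)) (phi t (phi (L *+ j) z')) <= e / 2) ->
  flow_metric phi d N z z' < e.
Proof.
move=> hphi L0 N0 NLn e0 H; apply: le_lt_trans (_ : e / 2 < e); last lra.
apply: ge_sup.
  by exists (d (phi 0 z) (phi 0 z')), 0 => //; rewrite /= in_itv/= lexx.
move=> _ [t /= + <-]; rewrite in_itv/= => /andP[t0 tN].
have := truncn_itv (divr_ge0 t0 (ltW L0)).
set j := Num.truncn _ => /andP[j1 j2].
have Lj : L *+ j <= t by rewrite -mulr_natl -ler_pdivlMr.
have tj : t < L *+ j.+1 by rewrite -mulr_natl -ltr_pdivrMr.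
rewrite -(subrK (L *+ j) t) !(flowD hphi (t - L *+ j)); apply: H.
  by have := le_lt_trans Lj (le_lt_trans tN NLn); rewrite ltr_pMn2l.
by move: tj; rewrite mulrSr => tj; apply/andP; split; lra.
Qed.

Section coordinates.
Context (R : realType) (Z : topologicalType) (phi : R -> Z -> Z).
Context (d : Z -> Z -> R) (V : finType) (B : V -> set Z) (F : set Z) (m : nat).
Context (e L : R).
Hypotheses (hd : compatible_metric d) (cZ : compact [set: Z]).
Hypotheses (hphi : is_flow phi) (cF : closed F).
Hypothesis nF : flow_null phi (sweep phi 0 1 F).
Hypothesis covB : forall z, exists v, B v z.
Hypothesis cB : forall v, closed (B v).
Hypothesis multB : forall z, ~ F z -> (#|[set v | `[< B v z >]]%SET| <= m)%N.
Hypotheses (e_gt0 : 0 < e) (L_ge1 : 1 <= L).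
Hypothesis smallB : forall v z z', B v z -> B v z' ->
  forall t, 0 <= t <= L -> d (phi t z) (phi t z') < e / 6.

Let L_gt0 : 0 < L. Proof. exact: lt_le_trans L_ge1. Qed.

Let G (q : R * Z) := phi q.1 q.2.
Let cG : continuous G. Proof. exact: continuous_flow. Qed.

(** [W] is so thin that its orbits stay, for times in [[0, 1]], in a neighbourhood [U] of
    [sweep phi 0 1 F]; discrete visits to [W] are charged to the occupation of [U]. *)
Lemma null_neighborhood_visits (delta : R) : 0 < delta ->
  exists W, [/\ open W, F `<=` W & exists n0, forall n z, (n0 <= n)%N ->
    (\sum_(j < n) `[< W (phi (L *+ j) z) >])%:R <= delta * (L *+ n)].
Proof.
move=> delta0.
have cF1 : closed (sweep phi 0 1 F) by apply: (@closed_sweep _ _ _ hphi d).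
have [U [oU FU [N0 occ]]] := flow_null_occupation hd cZ hphi cF1 nF delta0.
have [r r0 rU] := cmetric_compact_nbhs hd (closed_compact cZ cF1) oU FU.
have [s s0 sG] := compact_uniform_continuous 1 hd hd cZ cG r0.
exists (\bigcup_(x in F) [set y | d x y < s]°); split.
- by apply: bigcup_open => x _; exact: open_interior.
- by move=> x Fx; exists x => //; exact: nbhs_cmetric_ball.
exists (Num.truncn (N0 / L)).+1 => n z n0n.
apply: le_trans (occ _ z _).
  apply: visit_count_le => // y t [x Fx /interior_subset xy] t01.
  apply: (rU (phi t x)); first by exists t; [rewrite /= in_itv|exists x].
  by apply: (sG t t x y t01) => //; rewrite subrr normr0.
rewrite -mulr_natl -ler_pdivrMr//.
apply/ltW/(lt_le_trans (truncnS_gt _)); by rewrite ler_nat.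
Qed.

(* The coordinates are the bumps around the boxes B v, at the times jL, j < n:
   at most m of them are nonzero at time jL, or |V| if phi (jL) z lies in the
   neighbourhood W of F. *)
Lemma widim_flow_metric_le (delta : R) : 0 < delta -> exists n0, forall n N,
  (n0 <= n)%N -> 0 <= N -> N < L *+ n ->
  (widim e (flow_metric phi d N) <=
    (m%:R *+ n + #|V|%:R * (delta * (L *+ n)))%:E)%E.
Proof.
move=> delta0.
have [W [oW FW [n0 visW]]] := null_neighborhood_visits delta0.
have mW z : ~ W z -> (#|[set v | `[< B v z >]]%SET| <= m)%N.
  by move=> nWz; apply: multB => /FW.
have [rho1 rho10 Hrho1] := swelling_multiplicity hd cZ cB oW mW.
have e60 : 0 < e / 6 by rewrite divr_gt0.
have [rho2 rho20 Hrho2] := compact_uniform_continuous L hd hd cZ cG e60.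
(* [rho1] preserves the multiplicity off [W]; [rho2] keeps [rho]-close points within [e / 6] up to
   time [L]. *)
pose rho := Num.min rho1 rho2.
have rho0 : 0 < rho by rewrite lt_min rho10.
have rho_1 : rho <= rho1 by rewrite ge_min lexx.
have rho_2 : rho <= rho2 by rewrite ge_min lexx orbT.
exists n0 => n N n0n N0 NLn.
pose h (p : V * 'I_n) (z : Z) := metric_bump d rho (B p.1) (phi (L *+ p.2) z).
pose x := (m%:R *+ n + #|V|%:R * (delta * (L *+ n))) : R.
have x0 : 0 <= x.
  by rewrite addr_ge0 ?mulrn_wge0// !mulr_ge0 ?mulrn_wge0// ltW.
apply: le_trans (_ : (Num.truncn x)%:R%:E <= _)%E; last first.
  by rewrite lee_fin; have /andP[] := truncn_itv x0.
apply: (widim_le (h := h)) => //.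
- move=> p z; apply: (@continuous_comp _ _ _ (phi (L *+ p.2))
    (metric_bump d rho (B p.1))); first exact: continuous_flow_space.
  exact: continuous_metric_bump.
- move=> z; have := @card_pairs_le V n m (fun v j => h (v, j) z != 0)
    (fun j => `[< W (phi (L *+ j) z) >]) _.
  have -> : [set p | h (p.1, p.2) z != 0%R]%SET = [set p | h p z != 0%R]%SET.
    by apply/setP => -[v j]; rewrite !inE.
  move=> hle; apply: leq_trans (hle _) _.
    move=> j /asboolP nW; apply: leq_trans (Hrho1 _ nW).
    apply: subset_leq_card; apply/fintype.subsetP => v; rewrite !inE/=.
    move=> /(metric_bump_support hd rho0)[b Bb ?]; exists b => //.
    exact: lt_le_trans rho_1.
  rewrite truncn_ge_nat// natrD !natrM lerD//; first by rewrite mulr_natr.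
  by apply: ler_wpM2l => //; exact: visW.
move=> z z' zz'; apply: (flow_metric_lt hphi L_gt0 N0 NLn e_gt0) => j jn t tL.
set y := phi _ z; set y' := phi _ z'.
(* The bump of a box through [y] is nonzero at [y], hence also at [y']. Both points are then near
   [B v], and the path [y], [b], [b'], [y'] costs [e / 6] per step, [e / 2] in all. *)
have [v Bv] := covB y.
have hv : metric_bump d rho (B v) y != 0 by exact: metric_bump_neq0.
have := zz' (v, Ordinal jn); rewrite /h/= -/y -/y' => hvE.
have [b Bb yb] := metric_bump_support hd rho0 hv.
rewrite hvE in hv; have [b' Bb' yb'] := metric_bump_support hd rho0 hv.
have near w a : d w a < rho -> d (phi t w) (phi t a) < e / 6.
  move=> wa; apply: (Hrho2 t t w a tL); first by rewrite subrr normr0.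
  exact: lt_le_trans rho_2.
have h1 := near _ _ yb; have h2 := near _ _ yb'; have h3 := smallB Bb Bb' tL.
have := cmetric_triangle hd (phi t b) (phi t y) (phi t y').
have := cmetric_triangle hd (phi t b') (phi t b) (phi t y').
by rewrite (cmetric_sym hd (phi t b') (phi t y')); lra.
Qed.

End coordinates.

Theorem proposition3p10 (R : realType) (X : topologicalType)
  (cptX : compact [set: X]) (metX : metrizable R X)
  (T : X -> X) (homeoT : homeomorphism T)
  (f : X -> R) (cf : continuous f) (f_gt0 : forall x, 0 < f x)
  (sfbp : SFBP (suspension_flow T f))
  (d : suspension T f -> suspension T f -> R) (hd : compatible_metric d) :
  has_mdim (suspension_flow T f) d 0%E.
Proof.
have [dX hdX] := metX.
have [c [M [c0 cM]]] := compact_pos_bounds cptX cf f_gt0.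
have cZ := suspension_compact homeoT cptX c0 cM.
have hphi := suspension_flow_is_flow homeoT cf.
(* The growth rate already vanishes at every fixed scale. *)
exists (fun=> 0%E); split; last exact: cvg_cst.
move=> e e0; apply: cvge0_near => delta delta0.
have e60 : 0 < e / 6 by rewrite divr_gt0.
(* Since [L *+ n <= 2 * N] below, [6 *+ n] is at most [12 * N / L], which is below [delta / 2 * N]
   once [L > 24 / delta]. *)
pose L := 1 + 24 / delta.
have L24 : 24 / delta < L by rewrite ltrDr.
have L1 : 1 <= L by rewrite lerDl divr_ge0// ltW.
have L0 : 0 < L by exact: lt_le_trans L1.
have [V [B [F [cF nF covB smallB [cB multB]]]]] :=
  suspension_closed_cover homeoT cf cptX c0 cM hdX hd sfbp L e60.
(* [V] depends on [L], so the frequency of visits near [F] is prescribed only now. The factor 4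
   absorbs [L *+ n <= 2 * N] and the share [delta / 2]; [.+1] keeps [q] positive. *)
pose q := (4 * #|V|.+1%:R) : R.
have q0 : 0 < q by rewrite mulr_gt0.
have dq0 : 0 < delta / q by rewrite divr_gt0.
have [n0 Hn0] := widim_flow_metric_le hd cZ hphi cF nF covB cB multB e0 L1
  smallB dq0.
near=> N.
have N0 : 0 < N by near: N; apply: nbhs_pinfty_gt; exact: num_real.
(* Gives [L *+ n <= 2 * N], as [n] exceeds [N / L] by at most 1. *)
have NL : L <= N by near: N; apply: nbhs_pinfty_ge; exact: num_real.
(* Makes the lower bound [- N^-1], from [widim_geN1], at least [- delta]. *)
have Nd : delta^-1 <= N by near: N; apply: nbhs_pinfty_ge; exact: num_real.
have NLn0 : L *+ n0 <= N by near: N; apply: nbhs_pinfty_ge; exact: num_real.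
pose n := (Num.truncn (N / L)).+1.
have /andP[n1 n2] := truncn_itv (divr_ge0 (ltW N0) (ltW L0)).
have n0n : (n0 <= n)%N.
  apply: leqW; rewrite truncn_ge_nat; last by rewrite divr_ge0// ltW.
  by rewrite ler_pdivlMr// mulr_natl.
have NLn : N < L *+ n by rewrite -mulr_natl -ltr_pdivrMr.
have Ln2 : L *+ n <= 2 * N.
  have := n1; rewrite ler_pdivlMr// mulr_natl /n mulrSr; lra.
have H := Hn0 n N n0n (ltW N0) NLn.
have Hm := widim_geN1 e (flow_metric (suspension_flow T f) d N).
have NV0 : 0 < N^-1 by rewrite invr_gt0.
apply/andP; split.
  apply: le_trans (_ : ((-1)%:E * (N^-1)%:E <= _)%E); last first.
    by apply: lee_wpmul2r => //; rewrite lee_fin ltW.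
  by rewrite -EFinM lee_fin mulN1r lerN2 -[leRHS]invrK lef_pV2// posrE invr_gt0.
apply: le_trans (lee_wpmul2r _ H) _; first by rewrite lee_fin ltW.
rewrite -EFinM lee_fin ler_pdivrMr//.
have h1 : 6 *+ n <= delta / 2 * N.
  have : (6 *+ n) * L <= 12 * N.
    by rewrite mulrnAl -mulrnAr; lra.
  move=> h; have : (6 *+ n) * (24 / delta) <= 12 * N.
    by apply: le_trans h; apply: ler_wpM2l; [rewrite mulrn_wge0|exact: ltW].
  by rewrite mulrA ler_pdivrMr//; lra.
have h2 : #|V|%:R * (delta / q * (L *+ n)) <= delta / 2 * N.
  apply: (@le_trans _ _ (#|V|.+1%:R * (delta / q * (2 * N)))).
    apply: ler_pM => //; first by rewrite mulr_ge0 ?mulrn_wge0// ltW.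
      by rewrite ler_nat.
    by apply: ler_wpM2l => //; exact: ltW.
  rewrite mulrA [_ * (delta / q)]mulrC /q invfM (mulrA delta).
  rewrite mulfVK ?pnatr_eq0//.
  by lra.
by rewrite -[delta]mulr1 (_ : 1 = 1/2 + 1/2); [nra|lra].
Unshelve. all: by end_near.
Qed.
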